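(* Let $K$ be a field of arbitrary characteristic. Let $Q$ be the quiver with two vertices $1,2$ and three arrows: two loops $a,b$ at the vertex $1$, and one arrow $c:1\to 2$. Let $I$ be the two-sided ideal of the path algebra $KQ$ generated by $\{a^2,\ b^2,\ ab-ba,\ ac\}$, and let $A=KQ/I$ (the Xu--Snashall algebra). Let $T(A)$ be the trivial extension of $A$, let $\mathrm{HH}^*(T(A))$ be its Hochschild cohomology ring with the cup product, and let $\mathcal{N}$ be the ideal of $\mathrm{HH}^*(T(A))$ generated by its homogeneous nilpotent elements. Then the quotient $\mathrm{HH}^*(T(A))/\mathcal{N}$ is not finitely generated as a $K$-algebra.
   Context: Path convention: paths are composed from left to right, so that $ac$ denotes the path that first traverses the loop $a$ at $1$ and then the arrow $c:1\to 2$. Trivial extension: for a finite-dimensional $K$-algebra $\Lambda$, let $D(\Lambda)=\operatorname{Hom}_K(\Lambda,K)$ with the $\Lambda$-$\Lambda$-bimodule structure $(a\cdot f\cdot b)(x)=f(bxa)$ for $a,b,x\in\Lambda$, $f\in D(\Lambda)$. The trivial extension $T(\Lambda)$ is the associative $K$-algebra with underlying vector space $\Lambda\oplus D(\Lambda)$ and multiplication $(x,f)(y,g)=(xy,\ x\cdot g+f\cdot y)$ for $x,y\in\Lambda$, $f,g\in D(\Lambda)$. Hochschild cohomology: for a $K$-algebra $\Lambda$, the Hochschild cochain complex is $\mathrm{C}^\bullet(\Lambda)=\bigoplus_{n\ge 0}\mathrm{C}^n(\Lambda)$ with $\mathrm{C}^n(\Lambda)=\operatorname{Hom}_K(\Lambda^{\otimes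 n},\Lambda)$ (tensor products over $K$; $\mathrm{C}^0(\Lambda)=\Lambda$) and differential $\delta^n:\mathrm{C}^n(\Lambda)\to \mathrm{C}^{n+1}(\Lambda)$, $$\delta^n(f)(a_1\otimes\cdots\otimes a_{n+1})=(-1)^{n+1}a_1f(a_2\otimes\cdots\otimes a_{n+1})+\sum_{i=1}^n(-1)^{n+1-i}f(a_1\otimes\cdots\otimes a_{i-1}\otimes a_ia_{i+1}\otimes a_{i+2}\otimes\cdots\otimes a_{n+1})+f(a_1\otimes\cdots\otimes a_n)a_{n+1}.$$ Its cohomology is $\mathrm{HH}^*(\Lambda)=\bigoplus_{n\ge 0}\mathrm{HH}^n(\Lambda)$. The cup product of $f\in \mathrm{C}^m(\Lambda)$ and $g\in \mathrm{C}^n(\Lambda)$ is $$(f\cup g)(a_1\otimes\cdots\otimes a_{m+n})=(-1)^{mn}f(a_1\otimes\cdots\otimes a_m)\,g(a_{m+1}\otimes\cdots\otimes a_{m+n}),$$ which makes $\mathrm{C}^\bullet(\Lambda)$ a differential graded algebra and hence $\mathrm{HH}^*(\Lambda)$ a graded $K$-algebra. An element of $\mathrm{HH}^*(\Lambda)$ is homogeneous if it lies in some $\mathrm{HH}^n(\Lambda)$. *)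

(* Defs.v *)
From HB Require Import structures.
From mathcomp Require Import all_boot all_algebra.
From mathcomp Require Import boolp functions.

Set Implicit Arguments.
Unset Strict Implicit.
Unset Printing Implicit Defensive.

Import GRing.Theory.
Local Open Scope ring_scope.
Local Open Scope quotient_scope.

Section Ideals.
Variable (R : nzRingType).

Definition two_sided_ideal (I : {pred R}) :=
  [/\ zmod_closed I, forall a, {in I, forall u, a * u \in I}
    & forall a, {in I, forall u, u * a \in I}].

(* The two-sided ideal generated by G: the smallest one that contains G. *)
Definition ideal_span (G : R -> Prop) : {pred R} :=
  [pred x | `[< forall I : {pred R}, two_sided_ideal I ->
                  (forall g, G g -> g \in I) -> x \in I >]].

Lemma ideal_span_ideal G : two_sided_ideal (ideal_span G).
Proof.
split; first split.
- by apply/asboolP => I [[I0 _] _ _] _.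
- move=> x y /asboolP Sx /asboolP Sy; apply/asboolP => I idI GI.
  by have [[_ IB] _ _] := idI; apply: IB; [apply: Sx | apply: Sy].
- move=> a x /asboolP Sx; apply/asboolP => I idI GI.
  by have [_ Il _] := idI; apply: Il; apply: Sx.
- move=> a x /asboolP Sx; apply/asboolP => I idI GI.
  by have [_ _ Ir] := idI; apply: Ir; apply: Sx.
Qed.

Lemma ideal_span_min (G : R -> Prop) (I : {pred R}) : two_sided_ideal I ->
  (forall g, G g -> g \in I) -> {subset ideal_span G <= I}.
Proof. by move=> idI GI x /asboolP; apply. Qed.

(* Properness is required because the quotient is to be an [algType], and
   these are nonzero rings. *)
Record proper_ideal := ProperIdeal {
  pideal_mem :> {pred R};
  pidealP : two_sided_ideal pideal_mem;
  pideal1 : 1 \notin pideal_mem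
}.

HB.instance Definition _ (I : proper_ideal) :=
  GRing.isZmodClosed.Build R (pideal_mem I) (let: And3 h _ _ := pidealP I in h).

End Ideals.

Section QuotientAlgebra.
Variables (K : fieldType) (R : algType K) (I : proper_ideal R).

Definition quot_alg := {ideal_quot pideal_mem I}.
HB.instance Definition _ := GRing.Zmodule.on quot_alg.

Definition to_quot (x : R) : quot_alg := \pi_{ideal_quot pideal_mem I} x.

Lemma to_quot_eq x y : to_quot x = to_quot y <-> x - y \in pideal_mem I.
Proof.
rewrite /to_quot Quotient.idealrBE.
by split=> [->|/eqP].
Qed.

Lemma to_quotD x y : to_quot (x + y) = to_quot x + to_quot y.
Proof. by rewrite /to_quot raddfD. Qed.

Lemma to_quotB x y : to_quot (x - y) = to_quot x - to_quot y.
Proof. by rewrite /to_quot raddfB. Qed.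

Definition quot_repr (x : quot_alg) : R := repr x.

Lemma quot_reprK : cancel quot_repr to_quot.
Proof. by move=> x; rewrite /to_quot /quot_repr; apply: reprK. Qed.

Let IM1 a u : u \in pideal_mem I -> a * u \in pideal_mem I.
Proof. by case: (pidealP I) => _ h _; apply: h. Qed.
Let IM2 a u : u \in pideal_mem I -> u * a \in pideal_mem I.
Proof. by case: (pidealP I) => _ _ h; apply: h. Qed.

Definition quot_mul (x y : quot_alg) := to_quot (quot_repr x * quot_repr y).
Definition quot_scale (k : K) (x : quot_alg) := to_quot (k *: quot_repr x).

Lemma to_quotM x y : to_quot (x * y) = quot_mul (to_quot x) (to_quot y).
Proof.
apply/to_quot_eq.
have hx : x - quot_repr (to_quot x) \in pideal_mem I.
  by apply/to_quot_eq; rewrite quot_reprK.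
have hy : y - quot_repr (to_quot y) \in pideal_mem I.
  by apply/to_quot_eq; rewrite quot_reprK.
rewrite -[x * y](addrNK (quot_repr (to_quot x) * y)) -mulrBl -addrA -mulrBr.
by apply: rpredD; [apply: IM2 | apply: IM1].
Qed.

Lemma to_quotZ k x : to_quot (k *: x) = quot_scale k (to_quot x).
Proof.
apply/to_quot_eq; rewrite -scalerBr -mulr_algl; apply: IM1.
by apply/to_quot_eq; rewrite quot_reprK.
Qed.

Lemma quot_ind (P : quot_alg -> Prop) : (forall x, P (to_quot x)) -> forall x, P x.
Proof. by move=> h x; rewrite -[x]quot_reprK. Qed.

Fact quot_mulA : associative quot_mul.
Proof.
elim/quot_ind=> x; elim/quot_ind=> y; elim/quot_ind=> z.
by rewrite -!to_quotM mulrA.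
Qed.
Fact quot_mul1 : left_id (to_quot 1) quot_mul.
Proof. by elim/quot_ind=> x; rewrite -to_quotM mul1r. Qed.
Fact quot_mulr1 : right_id (to_quot 1) quot_mul.
Proof. by elim/quot_ind=> x; rewrite -to_quotM mulr1. Qed.
Fact quot_mulDl : left_distributive quot_mul +%R.
Proof.
elim/quot_ind=> x; elim/quot_ind=> y; elim/quot_ind=> z.
by rewrite -to_quotD -!to_quotM mulrDl to_quotD.
Qed.
Fact quot_mulDr : right_distributive quot_mul +%R.
Proof.
elim/quot_ind=> x; elim/quot_ind=> y; elim/quot_ind=> z.
by rewrite -to_quotD -!to_quotM mulrDr to_quotD.
Qed.
Fact quot_oner_neq0 : to_quot 1 != 0.
Proof.
apply/eqP; rewrite -(subrr (to_quot 0)) -to_quotB => /to_quot_eq.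
by rewrite !subr0; apply/negP/pideal1.
Qed.

HB.instance Definition _ := GRing.Zmodule_isNzRing.Build quot_alg
  quot_mulA quot_mul1 quot_mulr1 quot_mulDl quot_mulDr quot_oner_neq0.

Fact quot_scaleA a b v : quot_scale a (quot_scale b v) = quot_scale (a * b) v.
Proof. by elim/quot_ind: v => v; rewrite -!to_quotZ scalerA. Qed.
Fact quot_scale1 : left_id 1 quot_scale.
Proof. by elim/quot_ind=> v; rewrite -!to_quotZ scale1r. Qed.
Fact quot_scaleDr : right_distributive quot_scale +%R.
Proof.
move=> a; elim/quot_ind=> u; elim/quot_ind=> v.
by rewrite -to_quotD -!to_quotZ -to_quotD scalerDr.
Qed.
Fact quot_scaleDl v : {morph quot_scale^~ v : a b / a + b}.
Proof.
by elim/quot_ind: v => v a b; rewrite -!to_quotZ -to_quotD scalerDl.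
Qed.

HB.instance Definition _ := GRing.Zmodule_isLmodule.Build K quot_alg
  quot_scaleA quot_scale1 quot_scaleDr quot_scaleDl.

Fact quot_scalerAl (k : K) (u v : quot_alg) : k *: (u * v) = (k *: u) * v.
Proof.
elim/quot_ind: u => u; elim/quot_ind: v => v.
change (quot_scale k (quot_mul (to_quot u) (to_quot v)) =
        quot_mul (quot_scale k (to_quot u)) (to_quot v)).
by rewrite -to_quotM -!to_quotZ -to_quotM scalerAl.
Qed.
HB.instance Definition _ := GRing.Lmodule_isLalgebra.Build K quot_alg
  quot_scalerAl.
Fact quot_scalerAr (k : K) (u v : quot_alg) : k *: (u * v) = u * (k *: v).
Proof.
elim/quot_ind: u => u; elim/quot_ind: v => v.
change (quot_scale k (quot_mul (to_quot u) (to_quot v)) =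
        quot_mul (to_quot u) (quot_scale k (to_quot v))).
by rewrite -to_quotM -!to_quotZ -to_quotM scalerAr.
Qed.
HB.instance Definition _ := GRing.Lalgebra_isAlgebra.Build K quot_alg
  quot_scalerAr.

Fact to_quot_linear : linear to_quot.
Proof. by move=> k x y; rewrite to_quotD to_quotZ. Qed.
HB.instance Definition _ :=
  GRing.isLinear.Build K R quot_alg *:%R to_quot to_quot_linear.
Fact to_quot_monoid_morphism : monoid_morphism to_quot.
Proof. by split=> // x y; rewrite to_quotM. Qed.
HB.instance Definition _ :=
  GRing.isMonoidMorphism.Build R quot_alg to_quot to_quot_monoid_morphism.

End QuotientAlgebra.

(* Some finite list generates R: the only subalgebra containing it is R. *)
Definition fg_algebra (K : fieldType) (R : algType K) :=
  exists s : seq R, forall S : {pred R},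
    GRing.subalg_closed S -> {subset s <= S} -> forall x, x \in S.

Lemma triangle_sum (V : nmodType) n (F : nat -> nat -> V) :
  \sum_(i < n.+1) \sum_(k < (n - i).+1) F i (i + k)%N =
  \sum_(j < n.+1) \sum_(i < j.+1) F i j.
Proof.
transitivity (\sum_(i < n.+1) \sum_(j < n.+1 | (i <= j)%N) F i j).
  apply: eq_bigr => i _; have le_in : (i <= n)%N by rewrite -ltnS.
  rewrite -(big_mkord xpredT (fun k => F i (i + k)%N)).
  rewrite -(big_mkord (fun j => i <= j)%N (F i)).
  rewrite -subSn // [RHS](big_cat_nat (n := i)) ?leqW //=.
  rewrite [X in _ = X + _]big_nat_cond [X in _ = X + _]big1 ?add0r; last first.
    by move=> k /andP[/andP[_ lt_ki]]; rewrite leqNgt lt_ki.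
  rewrite -[X in _ = \sum_(X <= _ < _ | _) _]add0n big_addn.
  by apply: eq_big => k; rewrite ?leq_addl // addnC.
rewrite (exchange_big_dep xpredT) //=; apply: eq_bigr => j _.
by rewrite (big_ord_widen n.+1 (F^~ j)).
Qed.

Record quiver := Quiver {
  vertex : finType;
  arrow : finType;
  source : arrow -> vertex;
  target : arrow -> vertex;
  (* a quiver without vertices would have the zero path algebra *)
  vertex_gt0 : (0 < #|vertex|)%N
}.

Section PathAlgebra.
Variables (K : fieldType) (Q : quiver).

(* The pair (v, w) stands for the path that starts at the vertex v and
   traverses the arrows of w from left to right. *)
Definition word := (vertex Q * seq (arrow Q))%type.

Fixpoint is_path_from (v : vertex Q) (w : seq (arrow Q)) : bool :=
  if w is a :: w' then (source a == v) && is_path_from (target a) w' else true.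

Definition is_path (p : word) := is_path_from p.1 p.2.

Definition endpoint (v : vertex Q) (w : seq (arrow Q)) :=
  last v (map (@target Q) w).

Definition path_fun (f : word -> K^o) :=
  (forall p, ~~ is_path p -> f p = 0) /\
  (exists s : seq word, forall p, p \notin s -> f p = 0).

Definition path_fun_pred : {pred word -> K^o} := [pred f | `[< path_fun f >]].

(* The path algebra KQ: finitely supported K-valued functions on the set of
   paths, multiplied by convolution over the factorisations of a path. *)
Record path_algebra := PathAlgebra {
  path_coef :> word -> K^o;
  path_coefP : path_coef \in path_fun_pred
}.

HB.instance Definition _ := [isSub for path_coef].
HB.instance Definition _ := [Choice of path_algebra by <:].

Fact path_fun_submod : GRing.submod_closed path_fun_pred.
Proof.
split; first by apply/asboolP; split=> //; exists [::].
move=> k f g /asboolP[f1 [s fs]] /asboolP[g1 [t gt]].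
have E p : (k *: f + g) p = k *: f p + g p by [].
apply/asboolP; split=> [p np|].
  by rewrite E f1 // g1 // scaler0 addr0.
exists (s ++ t) => p; rewrite mem_cat negb_or => /andP[ps pt].
by rewrite E fs // gt // scaler0 addr0.
Qed.
HB.instance Definition _ :=
  GRing.SubChoice_isSubLmodule.Build K (word -> K^o) path_fun_pred path_algebra
    (GRing.submod_closed_semi path_fun_submod).

Lemma path_eqP (f g : path_algebra) : (forall p, f p = g p) -> f = g.
Proof. by move=> h; apply/val_inj/funext. Qed.

Lemma is_path_fromE v w i : is_path_from v w =
  is_path_from v (take i w) && is_path_from (endpoint v (take i w)) (drop i w).
Proof.
elim: w v i => [|a w IH] v [|i] //=.
by rewrite (IH _ i) andbA.
Qed.

Definition path_conv (f g : word -> K^o) (p : word) : K^o :=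
  \sum_(i < (size p.2).+1)
    f (p.1, take i p.2) * g (endpoint p.1 (take i p.2), drop i p.2).

Fact path_conv_subproof (f g : path_algebra) : path_conv f g \in path_fun_pred.
Proof.
case: f => f /= /asboolP[f1 [s fs]]; case: g => g /= /asboolP[g1 [t gt]].
apply/asboolP; split=> [[v w] np|].
  rewrite /path_conv big1 // => i _ /=.
  move: np; rewrite /is_path /= (is_path_fromE v w i) negb_and.
  case/orP => h; first by rewrite f1 ?mul0r.
  by rewrite g1 ?mulr0.
exists [seq (p.1, p.2 ++ q.2) | p <- s, q <- t] => -[v w] np.
rewrite /path_conv big1 // => i _ /=.
have [ps|ps] := boolP ((v, take i w) \in s); last by rewrite fs ?mul0r.
have [qt|qt] := boolP ((endpoint v (take i w), drop i w) \in t);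
  last by rewrite gt ?mulr0.
case/negP: np; apply/allpairsP.
by exists ((v, take i w), (endpoint v (take i w), drop i w)); rewrite /= cat_take_drop.
Qed.
Definition path_mul f g := PathAlgebra (path_conv_subproof f g).

Definition path_unit (p : word) : K^o := (p.2 == [::])%:R.
Fact path_unit_subproof : path_unit \in path_fun_pred.
Proof.
apply/asboolP; split; first by case=> v [].
exists [seq (v, [::]) | v <- enum (vertex Q)] => -[v [|a w]] //.
by case/negP; apply/mapP; exists v; rewrite ?mem_enum.
Qed.
(* The sum of the trivial paths. *)
Definition path_one := PathAlgebra path_unit_subproof.

Fact path_mulA : associative path_mul.
Proof.
move=> f g h; apply: path_eqP => -[v w] /=; rewrite /path_conv /=.
pose F i j := f (v, take i w) *
  g (endpoint v (take i w), take (j - i) (drop i w)) *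
  h (endpoint v (take j w), drop j w).
transitivity (\sum_(i < (size w).+1) \sum_(k < (size w - i).+1) F i (i + k)%N).
  apply: eq_bigr => i _; rewrite mulr_sumr size_drop; apply: eq_bigr => k _.
  rewrite /F addKn mulrA drop_drop addnC takeD.
  by rewrite /endpoint map_cat last_cat.
rewrite triangle_sum; apply: eq_bigr => j _.
have le_jw : (j <= size w)%N by rewrite -ltnS.
rewrite mulr_suml size_takel //; apply: eq_bigr => i _.
have le_ij : (i <= j)%N by rewrite -ltnS.
by rewrite /F take_takel // take_drop subnK.
Qed.

Fact path_mul1l : left_id path_one path_mul.
Proof.
move=> f; apply: path_eqP => -[v w] /=; rewrite /path_conv /= big_ord_recl /=.
rewrite take0 drop0 /path_unit /= mul1r big1 ?addr0 // => i _.
by case: w i => [|a w] [i hi] //=; rewrite mul0r.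
Qed.
Fact path_mulr1 : right_id path_one path_mul.
Proof.
move=> f; apply: path_eqP => -[v w] /=; rewrite /path_conv /= big_ord_recr /=.
rewrite take_size drop_size /path_unit /= mulr1 big1 ?add0r // => i _.
rewrite -size_eq0 size_drop subn_eq0 leqNgt ltn_ord.
by rewrite mulr0.
Qed.
Fact path_mulDl : left_distributive path_mul +%R.
Proof.
move=> f g h; apply: path_eqP => p /=.
rewrite -[RHS]/(path_conv f h p + path_conv g h p) /path_conv -big_split /=.
by apply: eq_bigr => i _; rewrite -mulrDl.
Qed.
Fact path_mulDr : right_distributive path_mul +%R.
Proof.
move=> f g h; apply: path_eqP => p /=.
rewrite -[RHS]/(path_conv f g p + path_conv f h p) /path_conv -big_split /=.
by apply: eq_bigr => i _; rewrite -mulrDr.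
Qed.
Fact path_oner_neq0 : path_one != 0.
Proof.
have /card_gt0P[v _] := vertex_gt0 Q.
apply/eqP => /(congr1 (fun f : path_algebra => f (v, [::]))) /eqP.
by rewrite [_ == _](oner_eq0 K).
Qed.

HB.instance Definition _ := GRing.Zmodule_isNzRing.Build path_algebra
  path_mulA path_mul1l path_mulr1 path_mulDl path_mulDr path_oner_neq0.

Fact path_scalerAl (k : K) (f g : path_algebra) : k *: (f * g) = (k *: f) * g.
Proof.
apply: path_eqP => p; rewrite -[LHS]/(k * path_conv f g p) mulr_sumr.
by apply: eq_bigr => i _; rewrite mulrA.
Qed.
HB.instance Definition _ := GRing.Lmodule_isLalgebra.Build K path_algebra
  path_scalerAl.
Fact path_scalerAr (k : K) (f g : path_algebra) : k *: (f * g) = f * (k *: g).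
Proof.
apply: path_eqP => p; rewrite -[LHS]/(k * path_conv f g p) mulr_sumr.
by apply: eq_bigr => i _; rewrite mulrCA.
Qed.
HB.instance Definition _ := GRing.Lalgebra_isAlgebra.Build K path_algebra
  path_scalerAr.

Definition arrow_fun (a : arrow Q) (p : word) : K^o :=
  (p == (source a, [:: a]))%:R.
Fact arrow_subproof a : arrow_fun a \in path_fun_pred.
Proof.
apply/asboolP; split=> [[v w] np|].
  rewrite /arrow_fun; case: eqP => // e.
  by move: np; rewrite e /is_path /= eqxx.
exists [:: (source a, [:: a])] => p; rewrite inE /arrow_fun => /negPf -> //.
Qed.
Definition arrow_elt (a : arrow Q) : path_algebra := PathAlgebra (arrow_subproof a).

Lemma path_mulE (f g : path_algebra) p : (f * g) p = path_conv f g p.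
Proof. by []. Qed.

End PathAlgebra.

Inductive xs_vertex := xs_1 | xs_2.
Inductive xs_arrow := xs_a | xs_b | xs_c.

Definition xs_vertex_code (v : xs_vertex) : 'I_2 :=
  match v with xs_1 => inord 0 | xs_2 => inord 1 end.
Definition xs_vertex_decode (i : 'I_2) :=
  if val i is 0%N then xs_1 else xs_2.
Fact xs_vertex_codeK : cancel xs_vertex_code xs_vertex_decode.
Proof. by case; rewrite /xs_vertex_decode /= inordK. Qed.
HB.instance Definition _ := Finite.copy xs_vertex (can_type xs_vertex_codeK).

Definition xs_arrow_code (a : xs_arrow) : 'I_3 :=
  match a with xs_a => inord 0 | xs_b => inord 1 | xs_c => inord 2 end.
Definition xs_arrow_decode (i : 'I_3) :=
  match val i with 0%N => xs_a | 1%N => xs_b | _ => xs_c end.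
Fact xs_arrow_codeK : cancel xs_arrow_code xs_arrow_decode.
Proof. by case; rewrite /xs_arrow_decode /= inordK. Qed.
HB.instance Definition _ := Finite.copy xs_arrow (can_type xs_arrow_codeK).

Fact xs_vertex_gt0 : (0 < #|{: xs_vertex}|)%N.
Proof. by apply/card_gt0P; exists xs_1. Qed.

Definition xs_quiver : quiver := {|
  vertex := xs_vertex;
  arrow := xs_arrow;
  source := fun _ => xs_1;
  target := fun x => if x is xs_c then xs_2 else xs_1;
  vertex_gt0 := xs_vertex_gt0
|}.

Section XuSnashall.
Variable (K : fieldType).

Definition xs_relations : seq (path_algebra K xs_quiver) :=
  let a := arrow_elt K (xs_a : arrow xs_quiver) in
  let b := arrow_elt K (xs_b : arrow xs_quiver) in
  let c := arrow_elt K (xs_c : arrow xs_quiver) in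
  [:: a ^+ 2; b ^+ 2; a * b - b * a; a * c].

Definition xs_ideal_mem : {pred path_algebra K xs_quiver} :=
  ideal_span (fun r => r \in xs_relations).

Fact xs_ideal_proper : 1 \notin xs_ideal_mem.
Proof.
pose e2 : word xs_quiver := (xs_2, [::]).
pose J : {pred path_algebra K xs_quiver} := 
    [pred f : path_algebra K xs_quiver | f e2 == 0].
have e2M (f g : path_algebra K xs_quiver) : (f * g) e2 = f e2 * g e2.
  by rewrite path_mulE /path_conv big_ord1.
have idJ : two_sided_ideal J.
  split; first split.
  - by rewrite inE.
  - move=> f g; rewrite !inE => /eqP f0 /eqP g0.
    by rewrite -[(f - g) e2]/(f e2 - g e2) f0 g0 subrr.
  - by move=> f g; rewrite !inE e2M => /eqP->; rewrite mulr0.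
  - by move=> f g; rewrite !inE e2M => /eqP->; rewrite mul0r.
have arr0 x : arrow_elt K (x : arrow xs_quiver) \in J.
  by rewrite inE /= /arrow_fun xpair_eqE andbF.
have [[_ JB] JMl _] := idJ.
have sub : {subset xs_ideal_mem <= J}.
  apply: ideal_span_min => // r; rewrite !in_cons in_nil orbF.
  case/or4P => /eqP->; try exact: JMl.
  by apply: JB; apply: JMl.
apply/negP => /sub; rewrite inE.
by rewrite [_ == _](oner_eq0 K).
Qed.

Definition xs_ideal := ProperIdeal (ideal_span_ideal _) xs_ideal_proper.

Definition xs_algebra : algType K := quot_alg xs_ideal.

End XuSnashall.

Section TrivialExtension.
Variables (K : fieldType) (A : algType K).

Definition dual_pred : {pred A -> K^o} := [pred f : A -> K^o | `[< linear f >]].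

Record linear_dual := LinearDual { dual_fun :> A -> K^o; dualP : dual_fun \in dual_pred }.

HB.instance Definition _ := [isSub for dual_fun].
HB.instance Definition _ := [Choice of linear_dual by <:].

Fact dual_submod : GRing.submod_closed dual_pred.
Proof.
split; first by apply/asboolP => k x y; rewrite scaler0 addr0.
move=> k f g /asboolP lf /asboolP lg; apply/asboolP => l x y.
have E z : (k *: f + g) z = k *: f z + g z by [].
rewrite !E lf lg !scalerDr !scalerA mulrC -!addrA; congr (_ + _).
by rewrite addrCA.
Qed.
HB.instance Definition _ :=
  GRing.SubChoice_isSubLmodule.Build K (A -> K^o) dual_pred linear_dual
    (GRing.submod_closed_semi dual_submod).

Lemma dual_eqP (f g : linear_dual) : (forall x, f x = g x) -> f = g.
Proof. by move=> h; apply/val_inj/funext. Qed.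

Lemma dual_linear (f : linear_dual) : linear f.
Proof. by apply/asboolP; apply: dualP. Qed.

Fact dual_act_subproof (a : A) (f : linear_dual) (b : A) :
  (fun x => f (b * x * a)) \in dual_pred.
Proof.
apply/asboolP => k x y.
by rewrite mulrDr mulrDl -scalerAr -scalerAl dual_linear.
Qed.
(* a . f . b *)
Definition dual_act a f b := LinearDual (dual_act_subproof a f b).

Definition trivial_extension := (A * linear_dual)%type.
HB.instance Definition _ := GRing.Lmodule.on trivial_extension.

Implicit Types p q r : trivial_extension.

Definition trivext_mul p q : trivial_extension :=
  (p.1 * q.1, dual_act p.1 q.2 1 + dual_act 1 p.2 q.1).
Definition trivext_one : trivial_extension := (1, 0).

Let addE (f g : linear_dual) x : (f + g) x = f x + g x. Proof. by []. Qed.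
Let faddE (u v : A -> K^o) x : (u + v) x = u x + v x. Proof. by []. Qed.
Let scaleE k (f : linear_dual) x : (k *: f) x = k *: f x. Proof. by []. Qed.
Let fD (f : linear_dual) x y : f (x + y) = f x + f y.
Proof. by have := dual_linear f 1 x y; rewrite !scale1r. Qed.
Let f0 (f : linear_dual) : f 0 = 0.
Proof. by apply: (addrI (f 0)); rewrite -fD !addr0. Qed.
Let fZ (f : linear_dual) k x : f (k *: x) = k *: f x.
Proof. by have := dual_linear f k x 0; rewrite f0 !addr0. Qed.

Fact trivext_mulA : associative trivext_mul.
Proof.
move=> [x f] [y g] [z h]; congr (_, _); rewrite /= ?mulrA //.
by apply: dual_eqP => t; rewrite !addE /= !faddE /= !mul1r !mulr1
  !mulrA addrA.
Qed.
Fact trivext_mul1 : left_id trivext_one trivext_mul.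
Proof.
move=> [x f]; congr (_, _); rewrite /= ?mul1r //.
by apply: dual_eqP => t; rewrite addE /= !mul1r mulr1 addr0.
Qed.
Fact trivext_mulr1 : right_id trivext_one trivext_mul.
Proof.
move=> [x f]; congr (_, _); rewrite /= ?mulr1 //.
by apply: dual_eqP => t; rewrite addE /= !mul1r mulr1 add0r.
Qed.
Fact trivext_mulDl : left_distributive trivext_mul +%R.
Proof.
move=> [x f] [y g] [z h]; congr (_, _); rewrite /= ?mulrDl //.
apply: dual_eqP => t; rewrite !addE /= !faddE !mulrDr fD -!addrA.
by congr (_ + _); rewrite addrCA.
Qed.
Fact trivext_mulDr : right_distributive trivext_mul +%R.
Proof.
move=> [x f] [y g] [z h]; congr (_, _); rewrite /= ?mulrDr //.
apply: dual_eqP => t; rewrite !addE /= !faddE !mulrDl fD -!addrA.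
by congr (_ + _); rewrite addrCA.
Qed.
Fact trivext_oner_neq0 : trivext_one != 0.
Proof. by apply/eqP => -[/eqP]; rewrite oner_eq0. Qed.
HB.instance Definition _ := GRing.Zmodule_isNzRing.Build trivial_extension
  trivext_mulA trivext_mul1 trivext_mulr1 trivext_mulDl trivext_mulDr
  trivext_oner_neq0.

Fact trivext_scalerAl (k : K) p q : k *: (p * q) = (k *: p) * q.
Proof.
case: p q => [x f] [y g]; congr (_, _); first by rewrite /= scalerAl.
by apply: dual_eqP => t; rewrite scaleE !addE /= -scalerAr fZ -scalerDr.
Qed.
HB.instance Definition _ := GRing.Lmodule_isLalgebra.Build K trivial_extension
  trivext_scalerAl.
Fact trivext_scalerAr (k : K) p q : k *: (p * q) = p * (k *: q).
Proof.
case: p q => [x f] [y g]; congr (_, _); first by rewrite /= scalerAr.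
by apply: dual_eqP => t; rewrite scaleE !addE /= -scalerAl -scalerAl fZ -scalerDr.
Qed.
HB.instance Definition _ := GRing.Lalgebra_isAlgebra.Build K trivial_extension
  trivext_scalerAr.

End TrivialExtension.

Section HochschildComplex.
Variables (K : fieldType) (A : algType K).

(* An n-tensor a_1 (x) ... (x) a_n is represented by the list [:: a_1; ...; a_n],
   and an element of C(A) = \bigoplus_n Hom_K(A^{(x) n}, A) by a single function
   on lists: its restriction to lists of size n is a K-multilinear map of n
   arguments, the component in C^n(A), and it vanishes for n large. *)
Definition is_cochain (f : seq A -> A) :=
  (forall s t, linear (fun x => f (s ++ x :: t))) /\
  (exists N, forall s, (N <= size s)%N -> f s = 0).

Definition cochain_pred : {pred seq A -> A} := [pred f | `[< is_cochain f >]].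

Record cochain := Cochain {
  cochain_fun :> seq A -> A;
  cochainP : cochain_fun \in cochain_pred
}.

HB.instance Definition _ := [isSub for cochain_fun].
HB.instance Definition _ := [Choice of cochain by <:].

Fact cochain_submod : GRing.submod_closed cochain_pred.
Proof.
split.
  apply/asboolP; split=> [s t k x y|]; last by exists 0%N.
  by rewrite /= scaler0 addr0.
move=> k f g /asboolP[lf [N fN]] /asboolP[lg [M gM]].
have E z : (k *: f + g) z = k *: f z + g z by [].
apply/asboolP; split=> [s t l x y|].
  rewrite !E lf lg !scalerDr !scalerA mulrC -!addrA; congr (_ + _).
  by rewrite addrCA.
exists (maxn N M) => s; rewrite geq_max => /andP[sN sM].
by rewrite E fN // gM // scaler0 addr0.
Qed.
HB.instance Definition _ :=
  GRing.SubChoice_isSubLmodule.Build K (seq A -> A) cochain_pred cochain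
    (GRing.submod_closed_semi cochain_submod).

Lemma cochain_eqP (f g : cochain) : (forall s, f s = g s) -> f = g.
Proof. by move=> h; apply/val_inj/funext. Qed.

(* The component of the cup product in degree n = size s is the sum, over i,
   of (-1)^(i(n-i)) f_i(a_1,...,a_i) g_(n-i)(a_(i+1),...,a_n). *)
Definition cup_fun (f g : seq A -> A) (s : seq A) : A :=
  \sum_(i < (size s).+1)
    (-1) ^+ (i * (size s - i)) *: (f (take i s) * g (drop i s)).

Fact cup_subproof (f g : cochain) : cup_fun f g \in cochain_pred.
Proof.
case: f => f /= /asboolP[lf [N fN]]; case: g => g /= /asboolP[lg [M gM]].
apply/asboolP; split=> [s t k x y|]; last first.
  exists (N + M)%N => s hs; rewrite /cup_fun big1 // => i _.
  have [hN|hN] := leqP N (size (take i s)); first by rewrite fN // mul0r scaler0.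
  rewrite gM ?mulr0 ?scaler0 //.
  rewrite -(leq_add2l (size (take i s))) -size_cat cat_take_drop.
  by apply: leq_trans hs; rewrite leq_add2r ltnW.
have sz z : size (s ++ z :: t) = (size s + size t).+1.
  by rewrite size_cat addnS.
rewrite /cup_fun !sz scaler_sumr -big_split /=; apply: eq_bigr => i _.
rewrite scalerA mulrC -scalerA -scalerDr; congr (_ *: _).
have [le_is|lt_si] := leqP i (size s).
  have tE z : take i (s ++ z :: t) = take i s by rewrite takel_cat.
  have dE z : drop i (s ++ z :: t) = drop i s ++ z :: t.
    rewrite drop_cat; case: ltnP => // le_si.
    have -> : (i : nat) = size s by apply/eqP; rewrite eqn_leq le_is.
    by rewrite subnn drop_size.
  by rewrite !tE !dE lg mulrDr scalerAr.
have iE : (i : nat) = (size s + (i - size s).-1.+1)%N by rewrite prednK ?subn_gt0 // subnKC // ltnW.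
have tE z : take i (s ++ z :: t) = s ++ z :: take (i - size s).-1 t.
  by rewrite {1}iE take_cat ltnNge leq_addr /= addKn.
have dE z : drop i (s ++ z :: t) = drop (i - size s).-1 t.
  by rewrite {1}iE drop_cat ltnNge leq_addr /= addKn.
by rewrite !tE !dE lf mulrDl scalerAl.
Qed.
Definition cup f g := Cochain (cup_subproof f g).

Definition cup_unit_fun (s : seq A) : A := if s is [::] then 1 else 0.
Fact cup_unit_subproof : cup_unit_fun \in cochain_pred.
Proof.
apply/asboolP; split; last by exists 1%N => -[].
by move=> [|u s] t k x y /=; rewrite scaler0 addr0.
Qed.
Definition cup_unit := Cochain cup_unit_subproof.

Fact cupA : associative cup.
Proof.
move=> f g h; apply: cochain_eqP => s /=; rewrite /cup_fun /=.
set n := size s.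
pose F i j := (-1) ^+ (i * (j - i) + i * (n - j) + (j - i) * (n - j)) *:
  (f (take i s) * g (take (j - i) (drop i s)) * h (drop j s)).
transitivity (\sum_(i < n.+1) \sum_(k < (n - i).+1) F i (i + k)%N).
  apply: eq_bigr => i _; rewrite size_drop mulr_sumr scaler_sumr.
  apply: eq_bigr => k _.
  have le_k : (k <= n - i)%N by rewrite -ltnS.
  rewrite /F addKn -scalerAr scalerA mulrA drop_drop -exprD subnDA.
  rewrite -mulnDr subnKC // [(k + i)%N]addnC.
  by [].
rewrite triangle_sum; apply: eq_bigr => j _.
have le_jn : (j <= n)%N by rewrite -ltnS.
rewrite size_takel // mulr_suml scaler_sumr; apply: eq_bigr => i _.
have le_ij : (i <= j)%N by rewrite -ltnS.
rewrite /F take_takel // take_drop subnK // -scalerAl scalerA -exprD.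
by rewrite -addnA -mulnDl subnKC // addnC.
Qed.
Fact cup1l : left_id cup_unit cup.
Proof.
move=> f; apply: cochain_eqP => s /=; rewrite /cup_fun big_ord_recl /=.
rewrite take0 drop0 mul0n scale1r mul1r big1 ?addr0 // => i _.
by case: s i => [|a s] [i hi] //=; rewrite mul0r scaler0.
Qed.
Fact cupr1 : right_id cup_unit cup.
Proof.
move=> f; apply: cochain_eqP => s /=; rewrite /cup_fun big_ord_recr /=.
rewrite take_size drop_size subnn muln0 scale1r mulr1 big1 ?add0r // => i _.
case E : (drop i s) => [|a t] /=; last by rewrite mulr0 scaler0.
by move: (congr1 size E) => /eqP; rewrite size_drop subn_eq0 leqNgt ltn_ord.
Qed.
Fact cupDl : left_distributive cup +%R.
Proof.
move=> f g h; apply: cochain_eqP => s.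
rewrite -[RHS]/(cup_fun f h s + cup_fun g h s) /= /cup_fun -big_split /=.
by apply: eq_bigr => i _; rewrite -scalerDr -mulrDl.
Qed.
Fact cupDr : right_distributive cup +%R.
Proof.
move=> f g h; apply: cochain_eqP => s.
rewrite -[RHS]/(cup_fun f g s + cup_fun f h s) /= /cup_fun -big_split /=.
by apply: eq_bigr => i _; rewrite -scalerDr -mulrDr.
Qed.
Fact cup_unit_neq0 : cup_unit != 0.
Proof.
apply/eqP => /(congr1 (fun f : cochain => f [::])) /eqP.
by rewrite [_ == _](oner_eq0 A).
Qed.
HB.instance Definition _ := GRing.Zmodule_isNzRing.Build cochain
  cupA cup1l cupr1 cupDl cupDr cup_unit_neq0.

Fact cup_scalerAl (k : K) (f g : cochain) : k *: (f * g) = (k *: f) * g.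
Proof.
apply: cochain_eqP => s; rewrite -[LHS]/(k *: cup_fun f g s) scaler_sumr.
by apply: eq_bigr => i _; rewrite -scalerAl !scalerA mulrC.
Qed.
HB.instance Definition _ := GRing.Lmodule_isLalgebra.Build K cochain
  cup_scalerAl.
Fact cup_scalerAr (k : K) (f g : cochain) : k *: (f * g) = f * (k *: g).
Proof.
apply: cochain_eqP => s; rewrite -[LHS]/(k *: cup_fun f g s) scaler_sumr.
by apply: eq_bigr => i _; rewrite -scalerAr !scalerA mulrC.
Qed.
HB.instance Definition _ := GRing.Lalgebra_isAlgebra.Build K cochain
  cup_scalerAr.

Lemma cupE (f g : cochain) s : (f * g) s = cup_fun f g s.
Proof. by []. Qed.

(* [contract i [:: a_1; ...; a_n]] replaces a_i, a_(i+1) (counted from 1) by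
   their product. *)
Definition contract (i : nat) (s : seq A) : seq A :=
  take i.-1 s ++ (s`_i.-1 * s`_i) :: drop i.+1 s.

(* The value at a list of size n.+1 is that of the component \delta^n, and
   there is no contribution to C^0. *)
Definition hochschild_diff (f : seq A -> A) (s : seq A) : A :=
  if s is a :: s' then
    (-1) ^+ size s *: (a * f s')
    + \sum_(1 <= i < size s) (-1) ^+ (size s - i) *: f (contract i s)
    + f (take (size s).-1 s) * last a s'
  else 0.

(* f |-> (-1)^n f on C^n, the sign of the graded Leibniz rule below. *)
Definition degree_twist (f : seq A -> A) (s : seq A) : A :=
  (-1) ^+ size s *: f s.

Lemma sign_parity (x y : nat) : odd x = odd y -> (-1) ^+ x = (-1) ^+ y :> K.
Proof. by rewrite -signr_odd => ->; rewrite signr_odd. Qed.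

Lemma contract_take i k (s : seq A) : (0 < i <= k)%N -> (k < size s)%N ->
  take k (contract i s) = contract i (take k.+1 s).
Proof.
move=> /andP[i0 ik] ks; rewrite /contract.
have i1 : (i.-1 <= size s)%N by apply: leq_trans (leq_pred _) _; apply: leq_trans ik (ltnW ks).
rewrite take_cat size_takel // ltnNge (leq_trans (leq_pred _) ik) /=.
rewrite take_takel ?(leq_trans (leq_pred _) (leqW ik)) //.
rewrite !nth_take ?ltnS // ?(leq_trans (leq_pred _) ik) //.
congr (_ ++ _); have -> : (k - i.-1 = (k - i).+1)%N by case: i i0 ik {i1} => //= i _ ik; rewrite -subSn // subSS.
rewrite /=; congr (_ :: _).
by rewrite take_drop addnS subnK.
Qed.

Lemma contract_drop i k (s : seq A) : (0 < i <= k)%N -> (k < size s)%N ->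
  drop k (contract i s) = drop k.+1 s.
Proof.
move=> /andP[i0 ik] ks; rewrite /contract.
have i1 : (i.-1 <= size s)%N by apply: leq_trans (leq_pred _) _; apply: leq_trans ik (ltnW ks).
rewrite drop_cat size_takel // ltnNge (leq_trans (leq_pred _) ik) /=.
have -> : (k - i.-1 = (k - i).+1)%N by case: i i0 ik {i1} => //= i _ ik; rewrite -subSn // subSS.
by rewrite /= drop_drop addnS subnK.
Qed.

Lemma take_contract i k (s : seq A) : (k < i)%N -> (i < size s)%N ->
  take k (contract i s) = take k s.
Proof.
case: i => // i ki si; rewrite /contract /=.
rewrite takel_cat ?take_takel // size_takel //; exact/ltnW/ltnW.
Qed.

Lemma drop_contract i k (s : seq A) : (k < i)%N -> (i < size s)%N ->
  drop k (contract i s) = contract (i - k) (drop k s).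
Proof.
case: i => // i ki si; rewrite /contract /=.
rewrite subSn //= !nth_drop subnKC // addnS subnKC // drop_drop.
rewrite [in RHS]addSn addSn subnK // take_drop subnK //.
rewrite drop_cat size_takel; last exact/ltnW/ltnW.
rewrite ltnS in ki; case: ltnP => // ik.
have -> : k = i by apply/eqP; rewrite eqn_leq ki.
by rewrite subnn drop0 [drop i (take i s)]drop_oversize ?size_take_min ?geq_minl.
Qed.

Lemma hochschild_diff_cup (f g : seq A -> A) s :
  hochschild_diff (cup_fun f g) s =
  cup_fun (hochschild_diff f) g s + cup_fun (degree_twist f) (hochschild_diff g) s.
Proof.
case: s => [|a s].
  by rewrite /cup_fun !big_ord1 /= mul0r mulr0 !scaler0 addr0.
set n := size s.
have szs : size (a :: s) = n.+1 by [].
pose P k := (-1) ^+ (n.+1 + k * (n - k)) *: (a * (f (take k s) * g (drop k s))).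
pose M1 k i := (-1) ^+ (n.+1 - i + k * (n - k)) *:
  (f (contract i (take k.+1 (a :: s))) * g (drop k.+1 (a :: s))).
pose M2 k i := (-1) ^+ (n.+1 - i + k * (n - k)) *:
  (f (take k (a :: s)) * g (contract (i - k) (drop k (a :: s)))).
pose L k := (-1) ^+ (k * (n - k)) *:
  (f (take k (a :: s)) * (g (drop k (take n (a :: s))) * last a s)).
pose X k := (-1) ^+ (k * n + n) *:
  (f (take k (a :: s)) * (last a (take k s) * g (drop k s))).
transitivity (\sum_(k < n.+1) (P k + (\sum_(1 <= i < k.+1) M1 k i +
    \sum_(k.+1 <= i < n.+1) M2 k i) + L k)).
  rewrite !big_split /= -/n; congr (_ + _ + _).
  - rewrite /cup_fun mulr_sumr scaler_sumr; apply: eq_bigr => k _.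
    by rewrite -scalerAr scalerA -exprD.
  - transitivity (\sum_(1 <= i < n.+1) \sum_(k < n.+1)
        (if (i <= k)%N then M1 k i else M2 k i)).
      rewrite [LHS]big_nat_cond [RHS]big_nat_cond.
      apply: eq_bigr => i; rewrite andbT => /andP[i0 iN].
      have szc : size (contract i (a :: s)) = n.
        rewrite size_cat size_takel ?szs /=; last first.
          exact: leq_trans (leq_pred _) (ltnW iN).
        rewrite size_drop -/n; case: i i0 iN => //= i _ iN.
        by rewrite addnS -addSn subnKC.
      rewrite /cup_fun szc scaler_sumr; apply: eq_bigr => k _.
      have kn : (k < size (a :: s))%N by [].
      rewrite scalerA -exprD; case: leqP => ik.
        by rewrite /M1 contract_take ?contract_drop ?i0.
      by rewrite /M2 take_contract ?drop_contract.
    rewrite -big_split exchange_big /=; apply: eq_bigr => k _.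
    rewrite (big_cat_nat (n := k.+1)) //=.
    congr (_ + _); apply: eq_big_nat => i /andP[h1 h2].
      by rewrite -ltnS h2.
    by rewrite leqNgt h1.
  - rewrite /cup_fun size_takel ?szs // mulr_suml; apply: eq_bigr => k _.
    have kn : (k <= n)%N by rewrite -ltnS.
    by rewrite -scalerAl take_takel // -mulrA.
transitivity (\sum_(k < n.+1) ((P k + \sum_(1 <= i < k.+1) M1 k i + X k) +
    (- X k + \sum_(k.+1 <= i < n.+1) M2 k i + L k))).
  apply: eq_bigr => k _; rewrite -!addrA; congr (_ + (_ + _)).
  by rewrite addNKr.
rewrite big_split; congr (_ + _); symmetry.
  rewrite /cup_fun szs big_ord_recl /= mul0r scaler0 add0r.
  apply: eq_bigr => k _.
  have kn : (k <= n)%N by rewrite -ltnS.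
  rewrite /bump /= add0n add1n subSS size_takel // !mulrDl !scalerDr.
  congr (_ + _ + _).
  - rewrite /P -scalerAl scalerA -exprD mulrA; congr (_ *: _).
    apply: sign_parity; rewrite !(oddD, oddM, oddB, oddS) //=.
    by case: (odd n); case: (odd k).
  - rewrite mulr_suml scaler_sumr; apply: eq_big_nat => i /andP[i0 ik].
    rewrite -scalerAl scalerA -exprD; congr (_ *: _).
    have iN : (i <= n.+1)%N by apply: leq_trans (ltnW ik) _.
    apply: sign_parity; rewrite !(oddD, oddM, oddB, oddS) //=; last exact: ltnW.
    by case: (odd n); case: (odd k); case: (odd i).
  - rewrite /X mulrA; congr (_ *: (f _ * _ * _)).
      apply: sign_parity; rewrite !(oddD, oddM, oddB, oddS) //=.
      by case: (odd n); case: (odd k).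
    by rewrite -[a :: take k s]/(take k.+1 (a :: s)) take_takel.
rewrite /cup_fun szs big_ord_recr /= drop_oversize //= mulr0 scaler0 addr0.
apply: eq_bigr => k _.
have kn : (k <= n)%N by rewrite -ltnS.
have dE : drop k (a :: s) = last a (take k s) :: drop k s.
  rewrite (drop_nth a) // (last_nth a) size_takel //.
  by rewrite -[a :: take k s]/(take k.+1 (a :: s)) nth_take.
have ltk : (k <= size (a :: s))%N by apply: ltnW.
have lastE : last (last a (take k s)) (drop k s) = last a s.
  by rewrite -last_cat cat_take_drop.
rewrite /degree_twist dE /= size_takel // size_drop -/n -subSn //.
rewrite !mulrDr !scalerDr; congr (_ + _ + _).
- have -> : - X k = (-1) ^+ (k * n + n).+1 *:
      (f (take k (a :: s)) * (last a (take k s) * g (drop k s))).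
    by rewrite exprS mulN1r scaleNr.
  rewrite -scalerAl -scalerAr !scalerA -!exprD; congr (_ *: _).
  apply: sign_parity; rewrite !(oddD, oddM, oddB, oddS) //=.
  by case: (odd n); case: (odd k).
- rewrite mulr_sumr scaler_sumr -[X in _ = \sum_(X <= _ < _) _]add1n big_addn.
  apply: eq_big_nat => i /andP[i0 ik].
  have kn1 : (k <= n.+1)%N by apply: leqW.
  have iN : (i + k <= n.+1)%N by rewrite addnC -leq_subRL // (ltnW ik).
  rewrite /M2 dE addnK -scalerAl -scalerAr !scalerA -!exprD.
  congr (_ *: _); apply: sign_parity.
  rewrite !(oddD, oddM, oddS) !oddB ?(ltnW ik) //= !(oddD, oddS).
  by case: (odd n); case: (odd k); case: (odd i).
- rewrite /L lastE -scalerAl scalerA -exprD -dE take_drop subnK //.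
  congr (_ *: _); apply: sign_parity.
  rewrite !(oddD, oddM, oddB, oddS) ?leqW //=.
  by case: (odd n); case: (odd k).
Qed.

Lemma degree_twistK (f : seq A -> A) s : degree_twist (degree_twist f) s = f s.
Proof. by rewrite /degree_twist scalerA -exprD addnn -signr_odd odd_double scale1r. Qed.

Lemma hochschild_diff_twist (f : seq A -> A) s :
  hochschild_diff (degree_twist f) s = - degree_twist (hochschild_diff f) s.
Proof.
case: s => [|a s]; first by rewrite /degree_twist /= scaler0 oppr0.
rewrite /degree_twist; set n := (size s).+1.
have szs : size (a :: s) = n by [].
have mE x : - ((-1) ^+ n *: x) = (-1) ^+ n.+1 *: x :> A.
  by rewrite exprS mulN1r scaleNr.
rewrite szs mE /hochschild_diff szs !scalerDr.
have e x : (-1) ^+ (size s) *: x = (-1) ^+ n.+1 *: x :> A.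
  by congr (_ *: _); apply: sign_parity; rewrite !oddS negbK.
congr (_ + _ + _).
- by rewrite -scalerAr e !scalerA mulrC.
- rewrite scaler_sumr; apply: eq_big_nat => i /andP[i0 ik].
  have -> : size (contract i (a :: s)) = size s.
    rewrite size_cat size_takel ?szs /=; last first.
      exact: leq_trans (leq_pred _) (ltnW ik).
    rewrite size_drop; case: i i0 ik => //= i _ ik.
    by rewrite addnS -addSn subnKC.
  by rewrite e !scalerA mulrC.
- by rewrite size_takel /= ?leqW // e scalerAl.
Qed.

Lemma hochschild_diff_linear : linear hochschild_diff.
Proof.
move=> k f g; apply/funext => -[|a s].
  by rewrite -[RHS]/(k *: hochschild_diff f [::] + hochschild_diff g [::]) /= scaler0 addr0.
rewrite -[RHS]/(k *: hochschild_diff f (a :: s) + hochschild_diff g (a :: s)).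
rewrite /hochschild_diff; set n := size (a :: s).
have E t : (k *: f + g) t = k *: f t + g t by [].
rewrite !E mulrDr mulrDl !scalerDr -scalerAr -scalerAl.
under eq_bigr do rewrite E scalerDr scalerA mulrC -scalerA.
rewrite big_split /= -scaler_sumr scalerA mulrC -scalerA.
by rewrite [RHS]addrACA; congr (_ + _); rewrite addrACA.
Qed.

Fact degree_twist_subproof (f : cochain) : degree_twist f \in cochain_pred.
Proof.
case: f => f /= /asboolP[lf [N fN]]; apply/asboolP; split=> [s t k x y|].
  rewrite /degree_twist !size_cat /= lf scalerDr !scalerA; congr (_ *: _ + _).
  by rewrite mulrC.
by exists N => s sN; rewrite /degree_twist fN // scaler0.
Qed.
Definition cochain_twist f := Cochain (degree_twist_subproof f).

End HochschildComplex.

Section HochschildCohomology.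
Variables (K : fieldType) (A : algType K).
Local Notation cochain := (cochain A).

Definition cocycle_pred : {pred cochain} :=
  [pred f : cochain | `[< hochschild_diff f = 0 >]].

Record cocycle := Cocycle {
  cocycle_cochain :> cochain;
  cocycleP : cocycle_cochain \in cocycle_pred
}.

HB.instance Definition _ := [isSub for cocycle_cochain].
HB.instance Definition _ := [Choice of cocycle by <:].

Fact cocycle_subalg : GRing.subalg_closed cocycle_pred.
Proof.
split.
- apply/asboolP/funext => -[|a [|b s]] //=.
    by rewrite big_geq // mulr1 mul1r scaleN1r addr0 addNr.
  rewrite mulr0 scaler0 mul0r add0r addr0; apply: big1 => i _.
  rewrite [X in _ *: X](_ : _ = 0) ?scaler0 //.
  by rewrite /contract; case: (take _ _).
- move=> k f g /asboolP df /asboolP dg; apply/asboolP.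
  by rewrite [LHS]hochschild_diff_linear df dg scaler0 addr0.
- move=> f g /asboolP df /asboolP dg; apply/asboolP/funext => s.
  rewrite [LHS]hochschild_diff_cup df dg /cup_fun -[RHS]addr0.
  by congr (_ + _); apply: big1 => i _; rewrite ?mul0r ?mulr0 scaler0.
Qed.
HB.instance Definition _ :=
  GRing.SubChoice_isSubAlgebra.Build K cochain cocycle_pred cocycle
    (GRing.subalg_closed_semi cocycle_subalg).

(* Degree by degree this is the image of \delta, since \delta only maps the
   component C^n to C^(n+1). *)
Definition coboundary_pred : {pred cocycle} :=
  [pred z : cocycle | `[< exists g : cochain, z = hochschild_diff g :> (seq A -> A) >]].

Lemma cocycle_diff0 (z : cocycle) : hochschild_diff z = 0.
Proof. by apply/asboolP; apply: cocycleP. Qed.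

Fact coboundary_ideal : two_sided_ideal coboundary_pred.
Proof.
split; first split.
- apply/asboolP; exists 0.
  have := @hochschild_diff_linear K A (-1) 0 0.
  by rewrite scaler0 addr0 scaleN1r addNr => d0; rewrite [RHS]d0.
- move=> y z /asboolP[f yf] /asboolP[g zg]; apply/asboolP; exists (-1 *: g + f).
  by rewrite [RHS]hochschild_diff_linear -yf -zg scaleN1r addrC.
- move=> y z /asboolP[g zg]; apply/asboolP; exists (cochain_twist y * g).
  apply/funext => s; rewrite [RHS]hochschild_diff_cup.
  rewrite [X in _ = X + _]big1 ?add0r; last first.
    move=> i _; rewrite hochschild_diff_twist cocycle_diff0.
    by rewrite /degree_twist scaler0 oppr0 mul0r scaler0.
  rewrite -[LHS]/(cup_fun y z s) zg.
  by apply: eq_bigr => i _; rewrite degree_twistK.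
- move=> y z /asboolP[g zg]; apply/asboolP; exists (g * (y : cochain)).
  apply/funext => s; rewrite [RHS]hochschild_diff_cup.
  rewrite [X in _ = _ + X]big1 ?addr0; last first.
    by move=> i _; rewrite cocycle_diff0 mulr0 scaler0.
  by rewrite -[LHS]/(cup_fun z y s) zg.
Qed.

Fact coboundary_proper : 1 \notin coboundary_pred.
Proof.
apply/asboolP => -[g /(congr1 (fun f => f [::])) /eqP].
by rewrite [_ == _](oner_eq0 A).
Qed.

Definition coboundaries := ProperIdeal coboundary_ideal coboundary_proper.

Definition hochschild_cohomology : algType K := quot_alg coboundaries.
Local Notation HH := hochschild_cohomology.

Definition hh_class (z : cocycle) : HH := to_quot coboundaries z.

(* x lies in HH^n: it is the class of a cocycle concentrated in degree n. *)
Definition hh_degree (n : nat) (x : HH) :=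
  exists2 z : cocycle, x = hh_class z & forall s, size s != n -> z s = 0.

Definition hh_homogeneous (x : HH) := exists n, hh_degree n x.

Definition nilpotent (x : HH) := exists n, x ^+ n = 0.

Definition nil_ideal_mem : {pred HH} :=
  ideal_span (fun x => hh_homogeneous x /\ nilpotent x).

Fact nil_ideal_proper : 1 \notin nil_ideal_mem.
Proof.
pose ev (x : HH) : A := (quot_repr x : cocycle) [::].
have evE z : ev (hh_class z) = z [::].
  have /to_quot_eq /asboolP[g] : hh_class (quot_repr (hh_class z)) = hh_class z.
    exact: quot_reprK.
  by move/(congr1 (fun f => f [::])) => /= /eqP; rewrite subr_eq0 => /eqP.
have HHind (P : HH -> Prop) : (forall z, P (hh_class z)) -> forall x, P x.
  by move=> h x; rewrite -[x]quot_reprK; apply: h.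
have evB x y : ev (x - y) = ev x - ev y.
  by elim/HHind: x => x; elim/HHind: y => y; rewrite -[_ - _]to_quotB !evE.
have evM x y : ev (x * y) = ev x * ev y.
  elim/HHind: x => x; elim/HHind: y => y; rewrite -[_ * _]to_quotM !evE.
  by rewrite -[LHS]/(cup_fun x y [::]) /cup_fun big_ord1 scale1r.
have ev1 : ev 1 = 1 by rewrite -[1]/(hh_class 1) evE.
have evX x n : ev (x ^+ n) = ev x ^+ n.
  by elim: n => [|n IH]; rewrite ?expr0 // !exprS evM IH.
have evC x a : GRing.comm (ev x) a.
  elim/HHind: x => z; rewrite evE.
  have /(congr1 (fun f => f [:: a])) := cocycle_diff0 z.
  rewrite /= big_geq // addr0 scaleN1r => /eqP.
  by rewrite addrC subr_eq0 => /eqP.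
pose J : {pred HH} := [pred x | `[< exists n, ev x ^+ n = 0 >]].
have idJ : two_sided_ideal J.
  split; first split.
  - by apply/asboolP; exists 1%N; rewrite -(subrr 1) evB subrr expr1.
  - move=> x y /asboolP[n xn] /asboolP[m ym]; apply/asboolP; exists (n + m)%N.
    rewrite evB (exprBn_comm _ (evC x _)); apply: big1 => i _.
    have [le_mi|lt_im] := leqP m i.
      by rewrite -(subnK le_mi) [ev y ^+ _]exprD ym !mulr0 mul0rn.
    rewrite -addnBA ?(ltnW lt_im) // exprD xn mul0r mulr0 mul0r mul0rn //.
  - move=> a x /asboolP[n xn]; apply/asboolP; exists n.
    by rewrite evM exprMn_comm ?xn ?mulr0 //; apply: evC.
  - move=> a x /asboolP[n xn]; apply/asboolP; exists n.
    by rewrite evM exprMn_comm ?xn ?mul0r //; apply: evC.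
have sub : {subset nil_ideal_mem <= J}.
  apply: ideal_span_min => // x [_ [n xn]]; apply/asboolP; exists n.
  by rewrite -evX xn -(subrr 1) evB subrr.
apply/negP => /sub /asboolP[n]; rewrite ev1 expr1n => /eqP.
by rewrite oner_eq0.
Qed.

Definition nil_ideal := ProperIdeal (ideal_span_ideal _) nil_ideal_proper.

End HochschildCohomology.

(* Main.v *)
Require Import Defs.
From mathcomp Require Import all_boot all_algebra.
From mathcomp Require Import boolp functions.
From mathcomp Require Import ring zify.

Set Implicit Arguments.
Unset Strict Implicit.
Unset Printing Implicit Defensive.
Import GRing.Theory.
Local Open Scope ring_scope.

(** Let A be the Xu-Snashall algebra and T = T(A). The coefficient of e_1 is a
    character eps of T, and the elements a, b of T satisfy a^2 = b^2 = 0 and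
    ab = ba. Hence, for each n and j, the sum of all words of length n in the
    letters a, b with j letters b, where each word carries the sign of the
    permutation that sorts it, is a cycle for the bar complex of T with
    coefficients in K. Evaluating cocycles on these cycles and applying eps
    ([shuffle_eval]) is therefore well defined on HH^*(T), and it turns the cup
    product into the product of a skew polynomial ring in two variables x, y
    with xy = -yx, up to a further sign that only depends on degrees
    ([shuffle_eval_skew]). A skew polynomial ring is a domain, so nilpotent
    classes evaluate to 0 and the evaluation factors through the quotient of
    HH^*(T) by N. Its image S is not finitely generated, for two reasons.

    - S is contained in K + (y) ([xs_eval_a]): since aa = ac = 0, the cocycle
      condition at (a, ..., a, c) leaves only z(a, ..., a) c and a z(a, ..., a, c),
      and the coefficient of c in this relation is eps(z(a, ..., a)).
    - S contains x^(2m) y^2 for every m ([xs_eval_class]). Let f_a and f_b be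
      the 2-cochains of A that describe the infinitesimal deformations a^2 = t
      and b^2 = t. The second one is a cocycle; the first one is not, because
      ac = 0, but its coboundary takes values in the span of c and bc, and these
      annihilate from the left all values of f_a and f_b, which have no component
      at e_2. By the Leibniz rule f_a^m f_b is a cocycle of A, and it takes the
      value e_1 on (a, ..., a, b, b).

    A cocycle of A of even degree extends to T by summing over all cyclic
    rotations of its arguments ([cyclic_extension_cocycle]); this is the cocycle
    that deforms T(A) along with A.

    Finally, the span of the monomials x^i y^j with i + j <= M j is a subalgebra.
    Any finite subset of K + (y) lies in it for M large, but x^(2m) y^2 does not
    once m is large, so no finite set generates S ([skew_coefs_not_fg]). *)

(** * Coefficients in a skew polynomial ring *)

Section SkewCoefficients.
Variable K : fieldType.

(** The sign in the product of a monomial of degree k with l factors y by one of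
    degree m with h factors y: km comes from the cup product, and l(m + h) counts
    modulo 2 the pairs formed by a y of the left factor and an x of the right
    one. *)
Definition skew_sign (k l m h : nat) : K := (-1) ^+ (k * m + l * (m + h)).

(** [t x n j] is to be read as the coefficient, in the image of x under an algebra
    morphism to the skew polynomial ring, of the monomial of degree n with j
    factors y. *)
Definition skew_coefs (R : algType K) (t : R -> nat -> nat -> K) :=
  [/\ forall n j c x y, t (c *: x + y) n j = c * t x n j + t y n j,
      forall n j, t 1 n j = ((n == 0%N) && (j == 0%N))%:R
    & forall n j x y, t (x * y) n j =
        \sum_(k < n.+1) \sum_(l < j.+1)
          skew_sign k l (n - k) (j - l) * (t x k l * t y (n - k)%N (j - l)%N)].

Section Theory.
Variables (R : algType K) (t : R -> nat -> nat -> K).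
Hypothesis tP : skew_coefs t.

Lemma skew_coefsB x y n j : t (x - y) n j = t x n j - t y n j.
Proof.
have [tL _ _] := tP.
by rewrite addrC -scaleN1r tL mulN1r addrC.
Qed.

Lemma skew_coefs0 n j : t 0 n j = 0.
Proof. by rewrite -(subrr 0) skew_coefsB subrr. Qed.

(** The kernel of the evaluation is the ideal that has to contain the nilpotent
    classes. *)
Lemma skew_kernel_ideal : two_sided_ideal [pred x | `[< forall n j, t x n j = 0 >]].
Proof.
have [_ _ tM] := tP.
split; first split.
- by apply/asboolP => n j; apply: skew_coefs0.
- move=> x y /asboolP x0 /asboolP y0; apply/asboolP => n j.
  by rewrite skew_coefsB x0 y0 subrr.
- move=> a x /asboolP x0; apply/asboolP => n j.
  by rewrite tM big1 // => k _; rewrite big1 // => l _; rewrite x0 !mulr0.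
- move=> a x /asboolP x0; apply/asboolP => n j.
  by rewrite tM big1 // => k _; rewrite big1 // => l _; rewrite x0 mul0r mulr0.
Qed.

Definition lowest_term x n j :=
  [/\ forall k l, (k < n)%N -> t x k l = 0,
      forall l, (l < j)%N -> t x n l = 0 & t x n j != 0].

(** A skew polynomial ring is a domain: for the lexicographic order on (n, j), the
    lowest coefficient of a product is, up to sign, the product of the lowest
    coefficients. *)
Lemma lowest_term_mul x y n j m h : lowest_term x n j -> lowest_term y m h ->
  lowest_term (x * y) (n + m) (j + h).
Proof.
move=> [xn xj x0] [ym yh y0]; have [_ _ tM] := tP.
split=> [k l lt_k|l lt_l|].
- rewrite tM big1 // => a _; rewrite big1 // => b _.
  have [an|na] := ltnP a n; first by rewrite xn // mul0r mulr0.
  by rewrite ym ?mulr0 //; have := ltn_ord a; lia.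
- rewrite tM big1 // => a _; rewrite big1 // => b _.
  have [an|an|an] := ltngtP a n; first by rewrite xn // mul0r mulr0.
    by rewrite ym ?mulr0 //; have := ltn_ord a; lia.
  have [bj|jb] := ltnP b j; first by rewrite an xj // mul0r mulr0.
  by rewrite an addKn yh ?mulr0 //; have := ltn_ord b; lia.
- have lt_n : (n < (n + m).+1)%N by rewrite ltnS leq_addr.
  have lt_j : (j < (j + h).+1)%N by rewrite ltnS leq_addr.
  rewrite tM (bigD1 (Ordinal lt_n)) //= (bigD1 (Ordinal lt_j)) //= !addKn.
  rewrite [X in _ + X]big1 ?addr0 => [|a a_neq]; last first.
    rewrite big1 // => b _.
    have [an|an|an] := ltngtP a n; first by rewrite xn // mul0r mulr0.
      by rewrite ym ?mulr0 //; have := ltn_ord a; lia.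
    by case/eqP: a_neq; apply: val_inj.
  rewrite big1 ?addr0 => [|b b_neq]; last first.
    have [bj|bj|bj] := ltngtP b j; first by rewrite xj // mul0r mulr0.
      by rewrite yh ?mulr0 //; have := ltn_ord b; lia.
    by case/eqP: b_neq; apply: val_inj.
  by rewrite !mulf_neq0 // expf_neq0 // oppr_eq0 oner_eq0.
Qed.

Lemma lowest_termP x n j : t x n j != 0 -> exists k l, lowest_term x k l.
Proof.
move=> xnj; pose P k := `[< exists l, t x k l != 0 >].
have exP : exists k, P k by exists n; apply/asboolP; exists j.
case: (ex_minnP exP) => k /asboolP exl kmin.
case: (ex_minnP exl) => l xkl lmin; exists k, l; split=> // [k' l' | l'] lt'.
  apply/eqP; apply: contraLR lt' => neq0; rewrite -leqNgt kmin //.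
  by apply/asboolP; exists l'.
by apply/eqP; apply: contraLR lt' => neq0; rewrite -leqNgt lmin.
Qed.

Lemma skew_coefs_nilpotent x p n j : x ^+ p = 0 -> t x n j = 0.
Proof.
have [_ t1 _] := tP.
move=> xp0; apply/eqP/negPn/negP => /lowest_termP[k [l low]].
have: lowest_term (x ^+ p) (p * k) (p * l).
  elim: p {xp0} => [|p IH]; last by rewrite exprS !mulSn; apply: lowest_term_mul.
  by rewrite expr0; split=> //; rewrite t1 oner_neq0.
by rewrite xp0 => -[_ _]; rewrite skew_coefs0 eqxx.
Qed.

(** Used twice: to pass from cocycles to cohomology classes, and from these to the
    quotient by the nilpotent ideal. *)
Lemma skew_coefs_quot (I : Defs.proper_ideal R) :
    (forall x, x \in pideal_mem I -> forall n j, t x n j = 0) ->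
  skew_coefs (fun x : quot_alg I => t (quot_repr x)) /\
  forall x, t (quot_repr (to_quot I x)) =2 t x.
Proof.
move=> tI; have [tL t1 tM] := tP.
have tE x : t (quot_repr (to_quot I x)) =2 t x.
  move=> n j; apply/eqP; rewrite -subr_eq0 -skew_coefsB; apply/eqP/tI.
  by apply/to_quot_eq; rewrite quot_reprK.
split=> //; split=> [n j c|n j|n j].
- move=> x y; elim/(@quot_ind K R I): x => x.
  elim/(@quot_ind K R I): y => y; rewrite !tE -tL.
  by rewrite -[c *: to_quot I x]to_quotZ -to_quotD tE.
- exact: etrans (tE 1 n j) (t1 n j).
- move=> x y; elim/(@quot_ind K R I): x => x.
  elim/(@quot_ind K R I): y => y; rewrite -[_ * _]to_quotM tE tM.
  by apply: eq_bigr => k _; apply: eq_bigr => l _; rewrite !tE.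
Qed.

(** The coefficients with n <= M j only form a subalgebra S M for each M. Since
    the image of R lies in K + (y), every finite set is contained in some S M,
    whereas the degrees that occur together with y^2 are unbounded. *)
Lemma skew_coefs_not_fg :
    (forall x, exists N, forall n j, (N <= n)%N -> t x n j = 0) ->
    (forall x n, t x n.+1 0 = 0) ->
    (forall N, exists x n, (N < n)%N /\ t x n 2 != 0) ->
  ~ fg_algebra R.
Proof.
move=> tfin t0 tinf [s sgen]; have [tL t1 tM] := tP.
pose S M : {pred R} := [pred x | `[< forall n j, (M * j < n)%N -> t x n j = 0 >]].
have Ssub M : GRing.subalg_closed (S M).
  split.
  - by apply/asboolP => n j lt; rewrite t1; case: n lt.
  - move=> c x y /asboolP Sx /asboolP Sy; apply/asboolP => n j lt.
    by rewrite tL Sx // Sy // mulr0 addr0.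
  - move=> x y /asboolP Sx /asboolP Sy; apply/asboolP => n j lt.
    rewrite tM big1 // => k _; rewrite big1 // => l _.
    have le_kn : (k <= n)%N by rewrite -ltnS.
    have le_lj : (l <= j)%N by rewrite -ltnS.
    case: (ltnP (M * l) k) => kl; first by rewrite Sx // mul0r mulr0.
    by rewrite Sy ?mulr0 //; nia.
have [M sM] : exists M, {subset s <= S M}.
  elim: s {sgen} => [|x s [M sM]]; first by exists 0%N.
  have [N xN] := tfin x; exists (maxn M N) => y.
  rewrite inE => /orP[/eqP->|/sM/asboolP Sy]; apply/asboolP => n j lt.
    case: j lt => [|j] lt; first by case: n lt => // n _; apply: t0.
    by apply: xN; nia.
  by apply: Sy; apply: leq_ltn_trans lt; rewrite leq_mul2r leq_maxl orbT.
have [x [n [lt /eqP]]] := tinf (M * 2)%N; apply.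
by have /asboolP := sgen _ (Ssub M) sM x; apply.
Qed.

End Theory.
End SkewCoefficients.

(** * Signed sums over words in two letters *)

Section ShuffleSums.
Variable K : fieldType.
Implicit Types F G : seq bool -> K.

(** The sum of (-1)^inv(w) F(w) over the words w of length n with j letters [true],
    inv(w) being the number of pairs of a [true] followed later by a [false]. If w
    begins with [true], this letter contributes the number n' - j' of letters
    [false] in the rest of w; n' + j' has the same parity, and the terms with
    n' < j' vanish. *)
Fixpoint shuffle_sum (n j : nat) F : K :=
  if n is n'.+1 then
    shuffle_sum n' j (F \o cons false) +
    (if j is j'.+1 then (-1) ^+ (n' + j') * shuffle_sum n' j' (F \o cons true)
     else 0)
  else (j == 0%N)%:R * F [::].

Lemma shuffle_sumS n j F : shuffle_sum n.+1 j.+1 F =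
  shuffle_sum n j.+1 (F \o cons false) +
  (-1) ^+ (n + j) * shuffle_sum n j (F \o cons true).
Proof. by []. Qed.

Lemma eq_shuffle_sum n j F G : (forall w, size w = n -> F w = G w) ->
  shuffle_sum n j F = shuffle_sum n j G.
Proof.
elim: n j F G => [|n IH] j F G eqFG /=; first by rewrite eqFG.
congr (_ + _); first by apply: IH => w sw; apply: eqFG; rewrite /= sw.
by case: j => // j; congr (_ * _); apply: IH => w sw; apply: eqFG; rewrite /= sw.
Qed.

Lemma shuffle_sum_linear n j c F G :
  shuffle_sum n j (fun w => c * F w + G w) =
  c * shuffle_sum n j F + shuffle_sum n j G.
Proof.
elim: n j F G => [|n IH] j F G /=; first by ring.
rewrite [X in X + _](IH j (F \o cons false) (G \o cons false)).
case: j => [|j]; first by ring.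
by rewrite [X in _ + _ * X](IH j (F \o cons true) (G \o cons true)); ring.
Qed.

Lemma shuffle_sum0 n j : shuffle_sum n j (fun=> 0) = 0.
Proof.
have := shuffle_sum_linear n j (-1) (fun=> 0) (fun=> 0).
rewrite [X in _ = X + _]mulN1r [RHS]addNr => s0; apply: etrans s0.
by apply: eq_shuffle_sum => w _; rewrite mulr0 addr0.
Qed.

Lemma shuffle_sumZ n j c F :
  shuffle_sum n j (fun w => c * F w) = c * shuffle_sum n j F.
Proof.
rewrite -[RHS]addr0 -(shuffle_sum0 n j) -shuffle_sum_linear.
by apply: eq_shuffle_sum => w _; rewrite addr0.
Qed.

Lemma shuffle_sumD n j F G :
  shuffle_sum n j (fun w => F w + G w) = shuffle_sum n j F + shuffle_sum n j G.
Proof.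
rewrite -[X in X + _]mul1r -shuffle_sum_linear.
by apply: eq_shuffle_sum => w _; rewrite mul1r.
Qed.

Lemma shuffle_sum_sum n j (I : Type) (r : seq I) (F : I -> seq bool -> K) :
  shuffle_sum n j (fun w => \sum_(i <- r) F i w) =
  \sum_(i <- r) shuffle_sum n j (F i).
Proof.
elim: r => [|i r IH].
  rewrite big_nil -[RHS](shuffle_sum0 n j).
  by apply: eq_shuffle_sum => w _; rewrite big_nil.
rewrite big_cons -IH -shuffle_sumD.
by apply: eq_shuffle_sum => w _; rewrite big_cons.
Qed.

Lemma shuffle_sum_n0 n F : shuffle_sum n 0 F = F (nseq n false).
Proof. by elim: n F => [|n IH] F /=; rewrite ?mul1r // addr0 IH. Qed.

(** Cutting a word after k letters, inv is the sum of the inversions of the two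
    pieces and of the pairs across the cut, which number l times the count
    m - (j - l) of letters [false] in the right piece. *)
Lemma shuffle_sum_cat k m j F G :
  shuffle_sum (k + m) j (fun w => F (take k w) * G (drop k w)) =
  \sum_(l < j.+1) (-1) ^+ (l * (m + (j - l))) *
     (shuffle_sum k l F * shuffle_sum m (j - l) G).
Proof.
elim: k j F => [|k IH] j F.
  rewrite big_ord_recl big1 ?addr0 => [|l _] /=; last by rewrite !mul0r mulr0.
  rewrite mul0n expr0 !mul1r subn0 -shuffle_sumZ.
  by apply: eq_shuffle_sum => w _; rewrite take0 drop0.
rewrite addSn [LHS]/=.
rewrite [X in X + _](IH j (F \o cons false)).
case: j => [|j]; first by rewrite !big_ord1 /= !addr0.
rewrite [X in _ + _ * X](IH j (F \o cons true)).
transitivity (\sum_(l < j.+2) ((-1) ^+ (l * (m + (j.+1 - l))) *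
     (shuffle_sum k l (F \o cons false) * shuffle_sum m (j.+1 - l) G) +
   (if l : nat is l'.+1 then (-1) ^+ (l * (m + (j.+1 - l))) *
     ((-1) ^+ (k + l') * shuffle_sum k l' (F \o cons true) *
     shuffle_sum m (j.+1 - l) G) else 0))); last first.
  apply: eq_bigr => -[[|l] lt_l] _ /=; first by rewrite !addr0.
  by rewrite -mulrDr -mulrDl.
rewrite big_split /=; congr (_ + _).
rewrite [RHS]big_ord_recl /= add0r mulr_sumr; apply: eq_bigr => l _.
rewrite /bump /= add1n subSS !mulrA -!exprD; congr (_ ^+ _ * _ * _).
have := ltn_ord l; nia.
Qed.

(** Exchanging two distinct neighbours changes the parity of inv, so the terms
    cancel in pairs. This is what makes the shuffle sum a cycle: F will be a
    function of the word with the letters k and k + 1 multiplied together. *)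
Lemma shuffle_sum_antisym k n j F : (k.+2 <= n)%N ->
    (forall u x v, size u = k -> F (u ++ x :: x :: v) = 0) ->
    (forall u v, size u = k ->
       F (u ++ true :: false :: v) = F (u ++ false :: true :: v)) ->
  shuffle_sum n j F = 0.
Proof.
elim: k n j F => [|k IH] [|n] j F //= kn Fxx Fxy; last first.
  rewrite IH // => [||]; last 2 first.
  - by move=> u x v su; apply: (Fxx (false :: u)); rewrite /= su.
  - by move=> u v su; apply: (Fxy (false :: u)); rewrite /= su.
  case: j => [|j]; rewrite ?add0r // IH ?mulr0 //.
  - by move=> u x v su; apply: (Fxx (true :: u)); rewrite /= su.
  - by move=> u v su; apply: (Fxy (true :: u)); rewrite /= su.
case: n kn => // n _ /=.
have sxx l x : shuffle_sum n l ((F \o cons x) \o cons x) = 0.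
  rewrite -[RHS](shuffle_sum0 n l); apply: eq_shuffle_sum => w _.
  exact: (Fxx [::]).
have syx l : shuffle_sum n l ((F \o cons true) \o cons false) =
    shuffle_sum n l ((F \o cons false) \o cons true).
  by apply: eq_shuffle_sum => w _; apply: (Fxy [::]).
rewrite sxx add0r; case: j => [|j]; first by rewrite addr0.
rewrite syx addSn exprS; case: j => [|j]; first by ring.
by rewrite sxx; ring.
Qed.

End ShuffleSums.

(** * Cochains as multilinear functions on lists *)

Section Multilinear.
Variables (K : fieldType) (V W : lmodType K).

Definition multilinear (F : seq V -> W) :=
  forall s t, linear (fun x => F (s ++ x :: t)).

Lemma multilinear0 F s t : multilinear F -> F (s ++ 0 :: t) = 0.
Proof.
by move=> FL; have := FL s t (-1) 0 0; rewrite scaler0 addr0 scaleN1r addNr.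
Qed.

End Multilinear.

Section Cochains.
Variables (K : fieldType) (A : algType K).

Lemma contract_cat (u v : seq A) x y :
  contract (size u).+1 (u ++ x :: y :: v) = u ++ x * y :: v.
Proof.
rewrite /contract /= take_size_cat // !nth_cat ltnn subnn ltnNge leqnSn /=.
by rewrite subSnn drop_cat ltnNge -addn2 leq_addr addKn /= drop0.
Qed.

Definition concentrated n (f : seq A -> A) := forall s, size s != n -> f s = 0.

Lemma size_contract i (s : seq A) : (0 < i < size s)%N ->
  size (contract i s) = (size s).-1.
Proof.
by move=> i_s; rewrite /contract size_cat size_takel /= ?size_drop; lia.
Qed.

Lemma concentrated_diff n f : concentrated n f -> concentrated n.+1 (hochschild_diff f).
Proof.
move=> fn [|a s] // sn; rewrite /hochschild_diff.
have {}sn : size s != n by [].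
rewrite fn // mulr0 scaler0 fn ?mul0r ?addr0; last by rewrite size_takel /= ?leqW.
rewrite add0r big_nat big1 // => i i_s.
by rewrite fn ?scaler0 // size_contract.
Qed.

Lemma cup_concentrated n (f : seq A -> A) g s : concentrated n f -> (n <= size s)%N ->
  cup_fun f g s = (-1) ^+ (n * (size s - n)) *: (f (take n s) * g (drop n s)).
Proof.
move=> fn le_n; rewrite -ltnS in le_n.
rewrite /cup_fun (bigD1 (Ordinal le_n)) //= big1 ?addr0 // => i i_n.
rewrite fn ?mul0r ?scaler0 // size_takel; last by rewrite -ltnS.
by apply: contra i_n => /eqP i_n; apply/eqP/val_inj.
Qed.

Lemma concentrated_cup m n (f g : seq A -> A) :
  concentrated m f -> concentrated n g -> concentrated (m + n) (cup_fun f g).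
Proof.
move=> fm gn s sN; rewrite /cup_fun big1 // => i _.
have le_i : (i <= size s)%N by rewrite -ltnS.
have [im|im] := eqVneq (nat_of_ord i) m; last first.
  by rewrite fm ?mul0r ?scaler0 // size_takel.
by rewrite gn ?mulr0 ?scaler0 // size_drop; lia.
Qed.

Definition two_cochain_fun (B : A -> A -> A) (s : seq A) : A :=
  if s is [:: u; v] then B u v else 0.

Lemma two_cochain_subproof B : (forall u, linear (B u)) ->
  (forall v, linear (B ^~ v)) -> two_cochain_fun B \in @cochain_pred K A.
Proof.
move=> Bl Br; apply/asboolP; split=> [s t k x y|]; last first.
  by exists 3 => -[|? [|? [|? ?]]].
case: s => [|u [|v [|w s]]] /=; last by rewrite scaler0 addr0.
- case: t => [|v [|w t]]; rewrite ?scaler0 ?addr0 //; exact: Br.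
- case: t => [|v t]; rewrite ?scaler0 ?addr0 //; exact: Bl.
- by rewrite scaler0 addr0.
Qed.

(** The defect of associativity, to first order in t, of the product
    uv + t B(u, v). *)
Lemma two_cochain_diff B u v w : hochschild_diff (two_cochain_fun B) [:: u; v; w] =
  - (u * B v w) + (B (u * v) w - B u (v * w)) + B u v * w.
Proof.
rewrite /= big_nat_recl //= big_nat1 /contract /=.
by rewrite !exprS expr0 !mulr1 !mulN1r !opprK scale1r !scaleN1r.
Qed.

End Cochains.

(** * Evaluation of Hochschild cocycles on shuffle cycles *)

Section ShuffleEvaluation.
Variables (K : fieldType) (T : algType K) (eps : T -> K) (letter : bool -> T).
Hypothesis epsL : forall c x y, eps (c *: x + y) = c * eps x + eps y.
Hypothesis epsM : forall x y, eps (x * y) = eps x * eps y.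
Hypothesis eps1 : eps 1 = 1.
Hypothesis eps_letter : forall x, eps (letter x) = 0.
Hypothesis letter_sq : forall x, letter x * letter x = 0.
Hypothesis letter_comm : letter true * letter false = letter false * letter true.

Definition shuffle_eval (f : seq T -> T) n j :=
  shuffle_sum n j (fun w => eps (f (map letter w))).

Let eps0 : eps 0 = 0.
Proof. by have := epsL (-1) 0 0; rewrite scaler0 addr0 mulN1r addNr. Qed.
Let epsZ c x : eps (c *: x) = c * eps x.
Proof. by rewrite -[c *: x]addr0 epsL eps0 addr0. Qed.
Let epsD : {morph eps : x y / x + y}.
Proof. by move=> x y; rewrite -[x]scale1r epsL mul1r scale1r. Qed.
Let eps_sum I (r : seq I) P (F : I -> T) :
  eps (\sum_(i <- r | P i) F i) = \sum_(i <- r | P i) eps (F i).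
Proof. exact: (big_morph eps epsD eps0). Qed.

(** The two outer terms of the differential vanish because the character kills
    the letters, and the inner ones by antisymmetry, because the letters commute
    and have square zero. *)
Lemma shuffle_eval_diff (g : cochain T) n j :
  shuffle_eval (hochschild_diff g) n j = 0.
Proof.
have /asboolP[gL _] := cochainP g.
have g0 s t : g (s ++ 0 :: t) = 0 := multilinear0 s t gL.
case: n => [|n]; first by rewrite /shuffle_eval /= eps0 mulr0.
rewrite /shuffle_eval.
transitivity (shuffle_sum n.+1 j (fun w => \sum_(1 <= i < n.+1)
    (-1) ^+ (n.+1 - i) * eps (g (contract i (map letter w))))).
  apply: eq_shuffle_sum => -[|x w] //= [sw].
  rewrite size_map sw !epsD epsZ !epsM eps_letter mul0r mulr0 add0r.
  have -> : eps (last (letter x) (map letter w)) = 0 by rewrite last_map.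
  by rewrite mulr0 addr0 eps_sum; apply: eq_bigr => i _; rewrite epsZ.
rewrite shuffle_sum_sum big_nat big1 // => -[//|i] lt_i.
rewrite shuffle_sumZ (@shuffle_sum_antisym _ i) ?mulr0 //.
- move=> u x v su; rewrite map_cat /= -su -(size_map letter u) contract_cat.
  by rewrite letter_sq g0 eps0.
- move=> u v su; rewrite !map_cat /= -su -(size_map letter u) !contract_cat.
  by rewrite letter_comm.
Qed.

Lemma shuffle_eval_skew : skew_coefs (fun z : cocycle T => shuffle_eval z).
Proof.
split=> [n j c x y|n j|n j x y].
- have E s : (c *: x + y : cocycle T) s = c *: x s + y s by [].
  by rewrite -shuffle_sum_linear; apply: eq_shuffle_sum => w _; rewrite E epsL.
- case: n => [|n]; first by rewrite /shuffle_eval /= eps1 mulr1.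
  rewrite -[RHS](shuffle_sum0 K n.+1 j); apply: eq_shuffle_sum => -[|u w] //= _.
- rewrite /shuffle_eval.
  transitivity (shuffle_sum n j (fun w => \sum_(k < n.+1) (-1) ^+ (k * (n - k)) *
      (eps (x (map letter (take k w))) * eps (y (map letter (drop k w)))))).
    apply: eq_shuffle_sum => w sw.
    rewrite -[X in eps X]/(cup_fun x y (map letter w)) /cup_fun size_map sw eps_sum.
    by apply: eq_bigr => k _; rewrite epsZ epsM map_take map_drop.
  rewrite shuffle_sum_sum; apply: eq_bigr => k _.
  have -> : shuffle_sum n j = shuffle_sum (k + (n - k)) j.
    by rewrite subnKC // -ltnS.
  rewrite shuffle_sumZ.
  rewrite (shuffle_sum_cat _ _ _ (fun w => eps (x (map letter w)))
                           (fun w => eps (y (map letter w)))).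
  by rewrite mulr_sumr; apply: eq_bigr => l _; rewrite /skew_sign exprD !mulrA.
Qed.

End ShuffleEvaluation.

(** * Sums over cyclic rotations *)

Section CyclicSums.

Lemma sum_periodic (V : nmodType) P (h : nat -> V) c :
    (forall i, h (i + P)%N = h i) ->
  \sum_(i < P) h (i + c)%N = \sum_(i < P) h i.
Proof.
move=> hP; elim: c => [|c IH]; first by apply: eq_bigr => i _; rewrite addn0.
rewrite -{}IH; case: P hP => [|P] hP; first by rewrite !big_ord0.
rewrite big_ord_recr [RHS]big_ord_recl /= addrC add0n -(hP c) addnC.
by rewrite addSnnS addnC; congr (_ + _); apply: eq_bigr => i _; rewrite addSnnS.
Qed.

Lemma iter_rot (T : Type) (s : seq T) i : (i <= size s)%N ->
  iter i (rot 1) s = rot i s.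
Proof.
elim: i => [|i IH] lt_i; first by rewrite rot0.
by rewrite iterS IH ?(ltnW lt_i) // -rotS.
Qed.

Lemma iter_rot_size (T : Type) (s : seq T) : iter (size s) (rot 1) s = s.
Proof. by rewrite iter_rot // rot_size. Qed.

Lemma size_iter_rot (T : Type) (s : seq T) i : size (iter i (rot 1) s) = size s.
Proof. by elim: i => //= i <-; rewrite size_rot. Qed.

Definition cyclic_sum (V : nmodType) (T : Type) (F : seq T -> V) s :=
  \sum_(i < size s) F (iter i (rot 1) s).

Lemma cyclic_sum_rot (V : nmodType) (T : Type) (F : seq T -> V) c s :
  cyclic_sum F (iter c (rot 1) s) = cyclic_sum F s.
Proof.
rewrite /cyclic_sum size_iter_rot.
rewrite -(@sum_periodic _ _ (fun i => F (iter i (rot 1) s)) c) => [|i].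
  by apply: eq_bigr => i _; rewrite iterD.
by rewrite iterD iter_rot_size.
Qed.

Variables (K : fieldType) (V W : lmodType K).

Lemma multilinear_iter_rot (F : seq V -> W) i : multilinear F ->
  multilinear (fun s => F (iter i (rot 1) s)).
Proof.
elim: i F => [//|i IH] F FL.
have FL' : multilinear (F \o rot 1).
  case=> [|y s] t c u v; rewrite /= /rot /= ?drop0 ?take0 -?catA /=; exact: FL.
exact: (IH _ FL').
Qed.

Lemma multilinear_cyclic_sum (F : seq V -> W) :
  multilinear F -> multilinear (cyclic_sum F).
Proof.
move=> FL s t c x y.
have sE z : size (s ++ z :: t) = (size s + size t).+1 by rewrite size_cat addnS.
rewrite /cyclic_sum !sE scaler_sumr -big_split /=; apply: eq_bigr => i _.
exact: (multilinear_iter_rot i FL).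
Qed.

End CyclicSums.

(** * Cyclic extension of cocycles to the trivial extension *)

Section TrivialExtensionTheory.
Variables (K : fieldType) (A : algType K).
Local Notation T := (trivial_extension A).
Implicit Type f : linear_dual A.

Lemma dual0 f : f 0 = 0.
Proof.
by have := dual_linear f (-1) 0 0; rewrite scaler0 addr0 scaleN1r addNr.
Qed.

Lemma dualD f x y : f (x + y) = f x + f y :> K^o.
Proof. by have := dual_linear f 1 x y; rewrite !scale1r. Qed.

Lemma dualZ f c x : f (c *: x) = c * f x :> K^o.
Proof. by have := dual_linear f c x 0; rewrite dual0 !addr0. Qed.

Lemma dual_sum f I (r : seq I) P (F : I -> A) :
  f (\sum_(i <- r | P i) F i) = \sum_(i <- r | P i) f (F i) :> K^o.
Proof. by apply: (big_morph f) => [x y|]; [apply: dualD | apply: dual0]. Qed.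

Lemma mul_trivext2 (p q : T) x : (p * q).2 x = q.2 (x * p.1) + p.2 (q.1 * x).
Proof.
rewrite -[LHS]/(q.2 (1 * x * p.1) + p.2 (q.1 * x * 1)).
by rewrite mul1r mulr1.
Qed.

Lemma mul_inl (x y : A) : ((x, 0) : T) * (y, 0) = (x * y, 0).
Proof.
by apply: injective_projections => //; apply: dual_eqP => z; rewrite mul_trivext2 addr0.
Qed.

Lemma map_fst_contract i (u : seq T) : map fst (contract i u) = contract i (map fst u).
Proof.
have fst_nth j : (nth (0 : T) u j).1 = nth 0 (map fst u) j.
  case: (ltnP j (size u)) => ui; first by rewrite (nth_map 0).
  by rewrite !nth_default ?size_map.
by rewrite /contract map_cat /= -map_take -map_drop -!fst_nth.
Qed.

End TrivialExtensionTheory.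

Section CyclicExtension.
Variables (K : fieldType) (A : algType K).
Local Notation T := (trivial_extension A).
Variable g : cochain A.

Let gL : multilinear g.
Proof. by have /asboolP[] := cochainP g. Qed.

(** The cochain g as a form: the pairing of g(a_1, ..., a_n) with the dual
    component of one more argument, put at the head of the list. *)
Definition apply_head (s : seq T) : K^o :=
  if s is p :: s' then p.2 (g (map fst s')) else 0.

Lemma apply_head_multilinear : multilinear apply_head.
Proof.
case=> [|y s] t c u v //=; rewrite !map_cat /= gL.
exact: dual_linear.
Qed.

Lemma cyclic_extension_dual (s : seq T) :
  (fun x : A => cyclic_sum apply_head ((x, 0) :: s : seq T)) \in @dual_pred K A.
Proof.
apply/asboolP => c x y.
have -> : (c *: x + y, 0) = c *: ((x, 0) : T) + (y, 0).
  by congr pair; rewrite /= scaler0 addr0.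
exact: (multilinear_cyclic_sum apply_head_multilinear [::] s).
Qed.

(** Fed with one argument phi in D(A), at position i, and all others in A, this is
    the functional that maps x to
    phi (g (a_(i+1), ..., a_n, x, a_1, ..., a_(i-1))). *)
Definition cyclic_extension_fun (s : seq T) : T :=
  (g (map fst s), LinearDual (cyclic_extension_dual s)).

Lemma cyclic_extension_subproof :
  cyclic_extension_fun \in @cochain_pred K T.
Proof.
apply/asboolP; split=> [s t c u v|].
  congr pair; first by rewrite /= !map_cat /= gL.
  apply: dual_eqP => x.
  exact: (multilinear_cyclic_sum apply_head_multilinear ((x, 0) :: s) t).
have /asboolP[_ [N gN]] := cochainP g.
exists N => s sN; congr pair; first by rewrite gN // size_map.
apply: dual_eqP => x; rewrite /= /cyclic_sum big1 // => i _.
have : size (iter i (rot 1) ((x, 0) :: s : seq T)) = (size s).+1.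
  by rewrite size_iter_rot.
by case: (iter _ _ _) => //= p s' [sE]; rewrite gN ?size_map ?sE // dual0.
Qed.

Definition cyclic_extension := Cochain cyclic_extension_subproof.

End CyclicExtension.

Section CyclicCocycle.
Variables (K : fieldType) (A : algType K).
Local Notation T := (trivial_extension A).
Variable g : cochain A.
Local Notation omega := (cyclic_sum (apply_head g)).
Local Notation lift := (cyclic_extension g).

Let gL : multilinear g.
Proof. by have /asboolP[] := cochainP g. Qed.

Let omegaL : multilinear omega.
Proof. exact: multilinear_cyclic_sum (@apply_head_multilinear _ _ g). Qed.

(** Separating the two components of the head q: apart from the term in which the
    dual component of q is evaluated, the cyclic sum depends on q only through
    its component in A. *)
Lemma cyclic_sum_cons (q : T) s :
  omega (q :: s) = q.2 (g (map fst s)) + (lift s).2 q.1.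
Proof.
have qE : q = 1 *: ((0, q.2) : T) + (q.1, 0).
  by case: q => a f; congr pair; rewrite /= ?scale1r ?add0r ?addr0.
rewrite {1}qE (omegaL [::] s) scale1r; congr (_ + _) => //.
rewrite /cyclic_sum big_ord_recl [LHS]addrC big1 ?add0r // => i _.
have le_i : (i < size s)%N by have := ltn_ord i.
rewrite iter_rot /=; last exact: leqW.
rewrite /rot /=.
case E : (drop i s) => [|y u]; first by move: (size_drop i s) le_i; rewrite E /=; lia.
by rewrite /= map_cat /= (multilinear0 _ _ gL) dual0.
Qed.

(** As the cyclic sum is invariant under rotation, the pair to be multiplied may
    be brought to the front. *)
Lemma cyclic_sum_contract (t : seq T) i : (i.+1 < size t)%N ->
  omega (contract i.+1 t) = omega (contract 1 (iter i (rot 1) t)).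
Proof.
move=> lt_i; have le_i : (i <= size t)%N by lia.
rewrite iter_rot // /rot.
have st : size (take i t) = i by rewrite size_takel.
rewrite -{1}[t](cat_take_drop i).
move: (take i t) (drop i t) (size_drop i t) st => u v sv su.
case: v sv => [|x [|y v]] sv; [by move: sv => /=; lia | by move: sv => /=; lia |].
rewrite -{1}su contract_cat [contract 1 _](contract_cat [::] (v ++ u)).
rewrite -(cyclic_sum_rot _ i) iter_rot; last by rewrite size_cat su leq_addr.
by rewrite -su rot_size_cat.
Qed.

Lemma diff_cyclic_extension1 s :
  (hochschild_diff lift s).1 = hochschild_diff g (map fst s).
Proof.
case: s => [//|p s]; rewrite /hochschild_diff [map fst _]/= -[fst p :: _]/(map fst (p :: s)).
have fstZ c (u : T) : (c *: u).1 = c *: u.1 by [].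
have fstM (u v : T) : (u * v).1 = u.1 * v.1 by [].
have fstD (u v : T) : (u + v).1 = u.1 + v.1 by [].
have fst_sum I r P (F : I -> T) :
    (\sum_(i <- r | P i) F i).1 = \sum_(i <- r | P i) (F i).1.
  by apply: (big_morph (fun u : T => u.1)).
rewrite !fstD fst_sum fstZ !fstM size_map; congr (_ + _ + _ * _) => /=.
- apply: eq_bigr => i _; congr (_ *: g _).
  exact: (map_fst_contract i (p :: s)).
- by rewrite (map_take _ _ (p :: s)).
- by rewrite last_map.
Qed.

(** Paired with one more element (x, 0), the differential becomes an alternating
    sum over all pairs of cyclic neighbours in the list (x, 0) :: s: the first and
    last terms of the differential are those in which (x, 0) is multiplied. *)
Lemma diff_cyclic_extension2 s x : (0 < size s)%N ->
  (hochschild_diff lift s).2 x =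
  \sum_(i < (size s).+1) (-1) ^+ (size s + i) *
     omega (contract 1 (iter i (rot 1) (((x, 0) : T) :: s))).
Proof.
case: s => [//|p s] _; set N := size (p :: s).
have sndD (u v : T) : (u + v).2 x = u.2 x + v.2 x by [].
have sndZ c (u : T) : (c *: u).2 x = c * u.2 x by [].
have snd_sum I r P (F : I -> T) :
    (\sum_(i <- r | P i) F i).2 x = \sum_(i <- r | P i) (F i).2 x.
  exact: (big_morph (fun u : T => u.2 x)).
rewrite big_ord_recl [X in _ = _ + X]big_ord_recr [RHS]addrA.
rewrite /hochschild_diff -/N !sndD snd_sum sndZ; congr (_ + _ + _).
- rewrite addn0; congr (_ * _).
  rewrite mul_trivext2 cyclic_sum_cons mul_trivext2 /= addr0 addrC.
  by rewrite /drop; case: s {N}.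
- rewrite /N /= big_add1 big_mkord; apply: eq_bigr => i _.
  have lt_i := ltn_ord i.
  rewrite -[rot 1 _]/(iter i.+1 (rot 1) _) -cyclic_sum_contract /= ?ltnS //.
  rewrite -[LHS]/(_ * _); congr (_ * _).
  by apply: sign_parity; rewrite oddB ?oddD // ltnS ltnW.
- have -> : nat_of_ord (fintype.lift ord0 ord_max : 'I_N.+1) = N by [].
  rewrite -signr_odd oddD addbb mul1r iter_rot //.
  rewrite /N [p :: s]lastI size_rcons -cats1 /=.
  rewrite /rot /= drop_size_cat // take_size_cat // /contract /= drop0.
  rewrite cyclic_sum_cons mul_trivext2 /= add0r.
  rewrite -[LHS]/((last p s).2 (1 * x * g (map fst (belast p s))) +
    omega (((last p s).1 * x * 1, 0) :: belast p s)).
  by rewrite mul1r mulr1.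
Qed.

(** The three kinds of terms of the pairing of the head of a list with the
    differential of g at its tail. *)
Definition pair_first (r : seq T) : K^o :=
  if r is q :: p :: v then q.2 (p.1 * g (map fst v)) else 0.
Definition pair_last (r : seq T) : K^o :=
  if r is q :: v then q.2 (g (map fst (take (size v).-1 v)) * (last 0 v).1) else 0.
Definition pair_inner l (r : seq T) : K^o :=
  if r is q :: v then q.2 (g (map fst (contract l v))) else 0.

Lemma pair_diff (q p : T) v : q.2 (hochschild_diff g (map fst (p :: v))) =
  (-1) ^+ (size v).+1 * pair_first (q :: p :: v) +
  \sum_(1 <= l < (size v).+1) (-1) ^+ ((size v).+1 - l) * pair_inner l (q :: p :: v) +
  pair_last (q :: p :: v).
Proof.
rewrite /hochschild_diff [map fst _]/= -[fst p :: _]/(map fst (p :: v)).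
rewrite !dualD dualZ dual_sum size_map; congr (_ + _ + _) => //.
- by apply: eq_bigr => l _; rewrite dualZ /pair_inner map_fst_contract.
- by rewrite -map_take last_map.
Qed.

(** If the product p q is at the head, its dual component is p.1 q.2 + p.2 q.1,
    which gives an outer term of the differential of g for the heads q and p. All
    other rotations have the product inside the argument of g: an inner term. *)
Lemma cyclic_sum_mul (p q : T) u :
  omega (contract 1 (p :: q :: u)) =
  pair_last (rot 1 (p :: q :: u)) + pair_first (p :: q :: u) +
  \sum_(1 <= k < (size u).+1)
    pair_inner ((size u).+1 - k) (iter k.+1 (rot 1) (p :: q :: u)).
Proof.
rewrite [contract 1 _](contract_cat [::] u p q) /cyclic_sum [size _]/= big_ord_recl.
congr (_ + _).
  rewrite -[LHS]/((p * q).2 (g (map fst u))) mul_trivext2.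
  by rewrite rot1_cons /= size_rcons -cats1 take_size_cat // last_cat.
rewrite big_add1 big_mkord; apply: eq_bigr => k _.
have lt_k := ltn_ord k; rewrite [size _]/= in lt_k.
rewrite -[nat_of_ord (fintype.lift _ _)]/(k.+1).
move: (nat_of_ord k) lt_k => {}k lt_k.
have [u1 [y [u2 [uE u1k]]]] : exists u1 y u2, u = u1 ++ y :: u2 /\ size u1 = k.
  exists (take k u), (nth q u k), (drop k.+1 u).
  by rewrite -drop_nth // cat_take_drop size_takel ?(ltnW lt_k).
have -> : ((size u).+1 - k.+1)%N = (size u2).+1.
  by rewrite uE size_cat u1k /=; lia.
rewrite {}uE -{k lt_k}u1k !iter_rot /= ?size_cat /=; [|lia|lia].
rewrite /rot /= !drop_size_cat // !take_size_cat //.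
by rewrite /= contract_cat.
Qed.

(** Expanding [diff_cyclic_extension2] by [cyclic_sum_mul] gives a double sum over
    the rotations R i of a list of even length and over the terms of the
    differential of g. Shifting the index i, which is harmless since the sign
    (-1)^i is then well defined modulo the length, collects the terms with the
    same rotation R i, and they add up to the differential of g. In even degree
    no sign is needed in the definition of the extension. *)
Lemma cyclic_extension_cocycle n : ~~ odd n ->
    concentrated n g -> hochschild_diff g = 0 -> hochschild_diff lift = 0.
Proof.
move=> even_n gn dg; apply/funext => s.
case: (posnP (size s)) => [/size0nil->//|s_gt0].
apply: injective_projections; first by rewrite diff_cyclic_extension1 dg.
apply: dual_eqP => x; rewrite diff_cyclic_extension2 //.
set t : seq T := (x, 0) :: s; set N := size s.
have st i : size (iter i (rot 1) t) = N.+1 by rewrite size_iter_rot.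
(* For N even, g is only applied to lists of odd length N.-1. *)
case: (boolP (odd N)) => oddN; last first.
  apply: big1 => i _; rewrite /cyclic_sum big1 ?mulr0 // => k _.
  have : size (iter k (rot 1) (contract 1 (iter i (rot 1) t))) = N.
    rewrite size_iter_rot; move: (st i) s_gt0; rewrite -/N.
    case: (iter _ _ _) => [//|p [|q u]] [<-] // _.
    by rewrite [contract 1 _](contract_cat [::] u p q).
  case: (iter k _ _) => //= p u uN; rewrite gn ?dual0 //.
  by rewrite size_map; apply: contra oddN => /eqP un; rewrite -uN /= un.
pose R i := iter i (rot 1) t.
have RP i : R (i + N.+1)%N = R i.
  by rewrite /R iterD (iter_rot_size t : iter N.+1 _ _ = _).
have RD i k : R (i + k)%N = iter k (rot 1) (R i) by rewrite addnC /R iterD.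
(* The differential of the extension, and that of g, in terms of the R i. *)
have mulE i : omega (contract 1 (R i)) = pair_last (R i.+1) + pair_first (R i) +
    \sum_(1 <= k < N) pair_inner (N - k) (R (i + k.+1)%N).
  move: (st i) s_gt0; rewrite [R i.+1]/(rot 1 (R i)) -/(R i) -/N.
  under eq_bigr => k _ do rewrite RD.
  case: (R i) => [//|p [|q u]] [<-] // _.
  exact: cyclic_sum_mul.
have diffE i : (-1) ^+ N * pair_first (R i) +
    \sum_(1 <= l < N) (-1) ^+ (N - l) * pair_inner l (R i) + pair_last (R i) = 0.
  move: (st i) s_gt0; rewrite -/(R i) -/N.
  case: (R i) => [//|q [|p u]] [<-] // _.
  by rewrite -pair_diff dg dual0.
have signN : (-1) ^+ N = -1 :> K by rewrite -signr_odd oddN.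
pose sgn i : K := (-1) ^+ (N + i).
have shift (h : seq T -> K^o) c : \sum_(i < N.+1) sgn i * h (R (i + c)%N) =
    (-1) ^+ c * \sum_(i < N.+1) sgn i * h (R i).
  rewrite mulr_sumr -(@sum_periodic _ N.+1 (fun i => (-1) ^+ c * (sgn i * h (R i))) c).
    apply: eq_bigr => i _; rewrite /sgn mulrA -exprD; congr (_ * _).
    by apply: sign_parity; rewrite !oddD; case: (odd c); case: (odd i); case: (odd N).
  move=> i; rewrite RP /sgn; congr (_ * (_ * _)); apply: sign_parity.
  by rewrite !oddD /= oddN addbF.
transitivity (- \sum_(i < N.+1) sgn i * ((-1) ^+ N * pair_first (R i) +
    \sum_(1 <= l < N) (-1) ^+ (N - l) * pair_inner l (R i) +
    pair_last (R i))); last first.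
  by rewrite big1 ?oppr0 // => i _; rewrite diffE mulr0.
under eq_bigr => i _ do rewrite -/(R i) mulE !mulrDr mulr_sumr.
under [in RHS]eq_bigr => i _ do rewrite !mulrDr mulr_sumr.
rewrite !big_split /= !opprD -!addrA addrC -!addrA; congr (_ + _).
  by rewrite -sumrN; apply: eq_bigr => i _; rewrite signN mulN1r mulrN opprK.
rewrite addrC [RHS]addrC; congr (_ + _).
  rewrite -[RHS]mulN1r -[-1 in RHS]expr1 -shift.
  by apply: eq_bigr => i _; rewrite addn1.
rewrite exchange_big [in RHS]exchange_big /= -sumrN [RHS]big_nat_rev /=.
apply: eq_big_nat => k /andP[k_gt0 lt_k].
have -> : (1 + N - k.+1 = N - k)%N by lia.
rewrite shift -sumrN mulr_sumr; apply: eq_bigr => i _.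
rewrite subKn ?(ltnW lt_k) // exprS; ring.
Qed.
End CyclicCocycle.

(** * The basis of the Xu-Snashall algebra *)

Section PathBasis.
Variables (K : fieldType) (Q : quiver).
Local Notation P := (path_algebra K Q).

(** Zero when p is not a path, so that no proof of [is_path] has to be carried
    around. *)
Definition path_delta_fun (p q : word Q) : K^o := (is_path p && (q == p))%:R.

Lemma path_delta_subproof p : path_delta_fun p \in @path_fun_pred K Q.
Proof.
apply/asboolP; split=> [q|]; rewrite /path_delta_fun.
  by case: (q =P p) => [->|_]; rewrite ?andbF // andbT => /negPf->.
by exists [:: p] => q; rewrite inE => /negPf->; rewrite andbF.
Qed.

Definition path_delta p : P := PathAlgebra (path_delta_subproof p).

Lemma path_sum (f : P) (s : seq (word Q)) : (forall p, p \notin s -> f p = 0) ->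
  f = \sum_(p <- undup s) (f p : K) *: path_delta p.
Proof.
move=> fs; apply: path_eqP => q.
have -> : (\sum_(p <- undup s) (f p : K) *: path_delta p) q =
    \sum_(p <- undup s) f p * path_delta p q.
  by apply: (big_morph (fun h : P => h q)).
have /asboolP[f_path _] := path_coefP f.
have [qs|qs] := boolP (q \in s); last first.
  rewrite fs // big_seq big1 // => p; rewrite mem_undup => ps.
  rewrite /= /path_delta_fun; case: (q =P p) => [qp|]; last by rewrite andbF mulr0.
  by rewrite qp ps in qs.
rewrite (bigD1_seq q) ?mem_undup ?undup_uniq //= big1 ?addr0 => [|p pq].
  rewrite /path_delta_fun eqxx andbT.
  by case: (boolP (is_path q)) => [_|/f_path->]; rewrite ?mulr1 ?mul0r.
by rewrite /path_delta_fun eq_sym (negPf pq) andbF mulr0.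
Qed.

Lemma arrow_delta x : arrow_elt K x = path_delta (source x, [:: x]).
Proof.
by apply: path_eqP => q; rewrite /= /path_delta_fun /is_path /= eqxx.
Qed.

Lemma mul_arrow_delta x v w : arrow_elt K x * path_delta (v, w) =
  (target x == v)%:R *: path_delta (source x, x :: w).
Proof.
apply: path_eqP => -[v' w']; rewrite path_mulE -[RHS]/(_ * path_delta_fun _ _).
rewrite /path_conv /= /arrow_fun /path_delta_fun /is_path /= eqxx.
case: w' => [|y w'] /=.
  by rewrite big_ord1 /= !xpair_eqE !andbF mul0r mulr0.
rewrite !big_ord_recl [X in _ + (_ + X)]big1 /= => [|i _].
  rewrite take0 drop0 addr0 !xpair_eqE /= eqseq_cons !andbF mul0r add0r eqxx andbT.
  rewrite !eqseq_cons -!natrM !mulnb; congr (_%:R); rewrite /endpoint /=.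
  case: (y =P x) => [->|_]; rewrite ?andbF //= !andbT.
  have [->|_] := eqVneq (target x) v; last by rewrite !andbF.
  by rewrite andbCA.
case: w' i => [|z w'] [i lt_i] //=.
by rewrite xpair_eqE !eqseq_cons !andbF mul0r.
Qed.

End PathBasis.

(** The residue classes of the paths e_1, a, b, ab, c, bc, e_2. *)
Inductive xs_monomial := M1 | Ma | Mb | Mab | Mc | Mbc | M2.

Section XSCoordinates.
Variable K : fieldType.
Local Notation P := (path_algebra K xs_quiver).
Local Notation A := (xs_algebra K).

Definition xs_mul (u v : xs_monomial -> K) (i : xs_monomial) : K :=
  match i with
  | M1 => u M1 * v M1
  | Ma => u M1 * v Ma + u Ma * v M1
  | Mb => u M1 * v Mb + u Mb * v M1
  | Mab => u M1 * v Mab + u Ma * v Mb + u Mb * v Ma + u Mab * v M1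
  | Mc => u M1 * v Mc + u Mc * v M2
  | Mbc => u M1 * v Mbc + u Mb * v Mc + u Mbc * v M2
  | M2 => u M2 * v M2
  end.

Definition xs_word (v : xs_vertex) (w : seq xs_arrow) : word xs_quiver := (v, w).

(** Both paths ab and ba have the residue class [Mab]; paths that do not occur
    are zero modulo the relations. *)
Definition path_coord (f : P) (i : xs_monomial) : K :=
  match i with
  | M1 => f (xs_word xs_1 [::])
  | Ma => f (xs_word xs_1 [:: xs_a])
  | Mb => f (xs_word xs_1 [:: xs_b])
  | Mab => f (xs_word xs_1 [:: xs_a; xs_b]) + f (xs_word xs_1 [:: xs_b; xs_a])
  | Mc => f (xs_word xs_1 [:: xs_c])
  | Mbc => f (xs_word xs_1 [:: xs_b; xs_c])
  | M2 => f (xs_word xs_2 [::])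
  end.

Lemma path_coordL c (f g : P) i :
  path_coord (c *: f + g) i = c * path_coord f i + path_coord g i.
Proof.
have E p : (c *: f + g) p = c * f p + g p by [].
by case: i => //; rewrite /path_coord !E; ring.
Qed.

Lemma path_coordM (f g : P) i :
  path_coord (f * g) i = xs_mul (path_coord f) (path_coord g) i.
Proof.
by case: i; rewrite /xs_mul /path_coord !path_mulE /path_conv /= !big_ord_recl !big_ord0 /=
  /xs_word /endpoint /=; ring.
Qed.

Lemma path_coord_arrow x i :
  path_coord (arrow_elt K (x : arrow xs_quiver)) i =
  match x, i with xs_a, Ma | xs_b, Mb | xs_c, Mc => 1 | _, _ => 0 end.
Proof.
have E y w : arrow_elt K (x : arrow xs_quiver) (xs_word y w) =
  (xs_word y w == xs_word xs_1 [:: x])%:R by [].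
by case: x E => E; case: i; rewrite /path_coord !E;
   repeat (case: eqP => // _); rewrite ?addr0.
Qed.

(** By the product formula [path_coordM], the common kernel of the coordinates is
    an ideal; it contains the relations. *)
Lemma path_coord_ideal f : f \in pideal_mem (xs_ideal K) ->
  forall i, path_coord f i = 0.
Proof.
pose J : {pred P} := [pred f : P | `[< forall i, path_coord f i = 0 >]].
have xs_coord0 i : path_coord 0 i = 0.
  by have := path_coordL (-1) 0 0 i; rewrite scaler0 addr0 mulN1r addNr.
have idJ : two_sided_ideal J.
  split; first split.
  - by apply/asboolP.
  - move=> f1 f2 /asboolP e1 /asboolP e2; apply/asboolP => i.
    by rewrite addrC -scaleN1r path_coordL e1 e2 mulr0 addr0.
  - move=> g f1 /asboolP e1; apply/asboolP => i.
    by rewrite path_coordM; case: i; rewrite /xs_mul !e1 !mulr0 ?addr0.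
  - move=> g f1 /asboolP e1; apply/asboolP => i.
    by rewrite path_coordM; case: i; rewrite /xs_mul !e1 !mul0r ?addr0.
have sub : {subset xs_ideal K <= J}.
  apply: ideal_span_min => // r; rewrite !in_cons in_nil orbF.
  case/or4P => /eqP->; apply/asboolP => i; rewrite ?expr2.
  - by rewrite path_coordM; case: i; rewrite /xs_mul !path_coord_arrow; ring.
  - by rewrite path_coordM; case: i; rewrite /xs_mul !path_coord_arrow; ring.
  - rewrite addrC -scaleN1r path_coordL !path_coordM.
    by case: i; rewrite /xs_mul !path_coord_arrow; ring.
  - by rewrite path_coordM; case: i; rewrite /xs_mul !path_coord_arrow; ring.
by move=> /sub/asboolP.
Qed.

Definition xs_coord (x : A) := path_coord (quot_repr x).

Lemma xs_coord_to_quot f i : xs_coord (to_quot (xs_ideal K) f) i = path_coord f i.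
Proof.
have /to_quot_eq/path_coord_ideal/(_ i) :
    to_quot (xs_ideal K) (quot_repr (to_quot (xs_ideal K) f)) = to_quot _ f.
  exact: quot_reprK.
by rewrite addrC -scaleN1r path_coordL mulN1r => /eqP; rewrite addrC subr_eq0 => /eqP.
Qed.

Lemma xs_coordL c (x y : A) i :
  xs_coord (c *: x + y) i = c * xs_coord x i + xs_coord y i.
Proof.
move: x y; apply: quot_ind => x; apply: quot_ind => y.
by rewrite -[c *: _]to_quotZ -to_quotD !xs_coord_to_quot path_coordL.
Qed.

Lemma xs_coordM (x y : A) i :
  xs_coord (x * y) i = xs_mul (xs_coord x) (xs_coord y) i.
Proof.
move: x y; apply: quot_ind => x; apply: quot_ind => y.
rewrite -[_ * _]to_quotM xs_coord_to_quot path_coordM.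
by case: i; rewrite /xs_mul !xs_coord_to_quot.
Qed.

Lemma xs_coord0 i : xs_coord 0 i = 0.
Proof. by have := xs_coordL (-1) 0 0 i; rewrite scaler0 addr0 mulN1r addNr. Qed.
Lemma xs_coordD x y i : xs_coord (x + y) i = xs_coord x i + xs_coord y i.
Proof. by rewrite -[x]scale1r xs_coordL mul1r scale1r. Qed.
Lemma xs_coordZ c x i : xs_coord (c *: x) i = c * xs_coord x i.
Proof. by rewrite -[c *: x]addr0 xs_coordL xs_coord0 addr0. Qed.
Lemma xs_coordN x i : xs_coord (- x) i = - xs_coord x i.
Proof. by rewrite -scaleN1r xs_coordZ mulN1r. Qed.
Lemma xs_coord1 i : xs_coord 1 i = match i with M1 | M2 => 1 | _ => 0 end.
Proof.
rewrite [LHS]xs_coord_to_quot; case: i => //=.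
by rewrite /path_unit /= addr0.
Qed.

Definition xs_basis (i : xs_monomial) : A :=
  let q := to_quot (xs_ideal K) in
  let a := q (arrow_elt K (xs_a : arrow xs_quiver)) in
  let b := q (arrow_elt K (xs_b : arrow xs_quiver)) in
  let c := q (arrow_elt K (xs_c : arrow xs_quiver)) in
  match i with
  | M1 => q (path_delta K (xs_word xs_1 [::]))
  | Ma => a
  | Mb => b
  | Mab => a * b
  | Mc => c
  | Mbc => b * c
  | M2 => q (path_delta K (xs_word xs_2 [::]))
  end.

Definition xs_elt (u : xs_monomial -> K) : A :=
  \sum_(i <- [:: M1; Ma; Mb; Mab; Mc; Mbc; M2]) u i *: xs_basis i.

Lemma xs_coord_basis i j : xs_coord (xs_basis i) j =
  match i, j with
  | M1, M1 | Ma, Ma | Mb, Mb | Mab, Mab | Mc, Mc | Mbc, Mbc | M2, M2 => 1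
  | _, _ => 0
  end.
Proof.
have coord_vertex v k :
    xs_coord (to_quot (xs_ideal K) (path_delta K (xs_word v [::]))) k =
    match v, k with xs_1, M1 | xs_2, M2 => 1 | _, _ => 0 end.
  rewrite xs_coord_to_quot /path_coord /= /path_delta_fun /is_path /=.
  by case: v; case: k; repeat (case: eqP => // _); rewrite ?addr0.
case: i; rewrite /xs_basis ?coord_vertex ?xs_coordM ?xs_coord_to_quot ?path_coord_arrow.
all: by case: j; rewrite /xs_mul ?xs_coord_to_quot ?path_coord_arrow; ring.
Qed.

Lemma xs_coord_elt u i : xs_coord (xs_elt u) i = u i.
Proof.
rewrite /xs_elt !big_cons big_nil !xs_coordD xs_coord0 !xs_coordZ !xs_coord_basis.
by case: i; ring.
Qed.

Definition spanned (x : A) := exists u, x = xs_elt u.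

Lemma spannedL c x y : spanned x -> spanned y -> spanned (c *: x + y).
Proof.
move=> [u ->] [v ->]; exists (fun i => c * u i + v i).
rewrite /xs_elt scaler_sumr -big_split; apply: eq_bigr => i _.
by rewrite scalerA scalerDl.
Qed.

Lemma spanned0 : spanned 0.
Proof. by exists (fun=> 0); rewrite /xs_elt big1 // => i _; rewrite scale0r. Qed.

Lemma spanned_sum I (r : seq I) (c : I -> K) (F : I -> A) :
  (forall i, spanned (F i)) -> spanned (\sum_(i <- r) c i *: F i).
Proof.
move=> sF; elim: r => [|i r IH]; first by rewrite big_nil; apply: spanned0.
by rewrite big_cons; apply: spannedL.
Qed.

Lemma spanned_basis i : spanned (xs_basis i).
Proof.
exists (fun j => match i, j with
  | M1, M1 | Ma, Ma | Mb, Mb | Mab, Mab | Mc, Mc | Mbc, Mbc | M2, M2 => 1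
  | _, _ => 0
  end).
rewrite /xs_elt !big_cons big_nil.
by case: i; rewrite !scale0r ?scale1r ?add0r ?addr0.
Qed.

Lemma mul_arrow_basis x i :
  to_quot (xs_ideal K) (arrow_elt K (x : arrow xs_quiver)) * xs_basis i =
  match x, i with
  | xs_a, M1 => xs_basis Ma
  | xs_a, Mb => xs_basis Mab
  | xs_b, M1 => xs_basis Mb
  | xs_b, Ma => xs_basis Mab
  | xs_b, Mc => xs_basis Mbc
  | xs_c, M2 => xs_basis Mc
  | _, _ => 0
  end.
Proof.
pose q := to_quot (xs_ideal K).
have qM f g : q f * q g = q (f * g) by rewrite [RHS]to_quotM.
have q0 : q 0 = 0 by rewrite -(subrr 0) [LHS]to_quotB subrr.
have rel r : r \in xs_relations K -> q r = 0.
  move=> rr; rewrite -q0; apply/to_quot_eq; rewrite subr0.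
  by apply/asboolP => I _; apply.
pose a := arrow_elt K (xs_a : arrow xs_quiver).
pose b := arrow_elt K (xs_b : arrow xs_quiver).
pose c := arrow_elt K (xs_c : arrow xs_quiver).
have aa : q a * q a = 0 by rewrite qM -expr2 rel // inE eqxx.
have bb : q b * q b = 0 by rewrite qM -expr2 rel // !inE eqxx !orbT.
have ac : q a * q c = 0 by rewrite qM rel // !inE eqxx !orbT.
have ba : q b * q a = q a * q b.
  apply/eqP; rewrite eq_sym -subr_eq0 !qM -[_ - _]to_quotB; apply/eqP.
  by apply: rel; rewrite !inE eqxx !orbT.
have qx (y z : xs_arrow) :
    target (y : arrow xs_quiver) != source (z : arrow xs_quiver) ->
    q (arrow_elt K (y : arrow xs_quiver)) *
      q (arrow_elt K (z : arrow xs_quiver)) = 0.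
  move=> yz; rewrite qM (arrow_delta K (z : arrow xs_quiver)).
  by rewrite mul_arrow_delta (negPf yz) scale0r.
have qv (y : xs_arrow) v :
   q (arrow_elt K (y : arrow xs_quiver)) * q (path_delta K (xs_word v [::])) =
   (target (y : arrow xs_quiver) == v)%:R *: q (arrow_elt K (y : arrow xs_quiver)).
  by rewrite qM /xs_word mul_arrow_delta -arrow_delta [LHS]to_quotZ.
have v12 : (xs_1 == xs_2) = false by apply/eqP.
have v21 : (xs_2 == xs_1) = false by apply/eqP.
case: x; case: i.
- by rewrite [LHS]qv eqxx scale1r.
- exact: aa.
- by [].
- by rewrite -[LHS]/(q a * (q a * q b)) mulrA aa mul0r.
- exact: ac.
- by rewrite -[LHS]/(q a * (q b * q c)) mulrA -ba -mulrA ac mulr0.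
- by rewrite [LHS]qv v12 scale0r.
- by rewrite [LHS]qv eqxx scale1r.
- exact: ba.
- exact: bb.
- by rewrite -[LHS]/(q b * (q a * q b)) -ba mulrA bb mul0r.
- by [].
- by rewrite -[LHS]/(q b * (q b * q c)) mulrA bb mul0r.
- by rewrite [LHS]qv v12 scale0r.
- by rewrite [LHS]qv v21 scale0r.
- by apply: qx; rewrite /= v21.
- by apply: qx; rewrite /= v21.
- by rewrite -[LHS]/(q c * (q a * q b)) mulrA qx ?mul0r //= v21.
- by apply: qx; rewrite /= v21.
- by rewrite -[LHS]/(q c * (q b * q c)) mulrA qx ?mul0r //= v21.
- by rewrite [LHS]qv eqxx scale1r.
Qed.

(** Every path is a product of arrows with a vertex, and the span of the seven
    monomials is stable under multiplication by arrows from the left. *)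
Lemma xs_elt_spans x : spanned x.
Proof.
apply: (@quot_ind _ _ (xs_ideal K)) => f {x}.
have arrow_spanned y x : spanned x -> 
    spanned (to_quot (xs_ideal K) (arrow_elt K (y : arrow xs_quiver)) * x).
  move=> [u ->]; rewrite mulr_sumr.
  under eq_bigr => i _ do rewrite -scalerAr.
  apply: spanned_sum => i; rewrite mul_arrow_basis.
  by case: y; case: i; (apply: spanned0 || apply: spanned_basis).
have delta_spanned w v : spanned (to_quot (xs_ideal K) (path_delta K (xs_word v w))).
  elim: w v => [|y w IH] v.
    by case: v; [apply: (spanned_basis M1) | apply: (spanned_basis M2)].
  have [vy|vy] := eqVneq v (source (y : arrow xs_quiver)); last first.
    have -> : path_delta K (xs_word v (y :: w)) = 0.
      by apply: path_eqP => p; rewrite /= /path_delta_fun /is_path /= eq_sym (negPf vy).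
    rewrite (_ : to_quot _ 0 = 0); first exact: spanned0.
    by rewrite -(subrr 0) [LHS]to_quotB subrr.
  have := arrow_spanned y _ (IH (target (y : arrow xs_quiver))).
  by rewrite -[_ * _]to_quotM mul_arrow_delta eqxx scale1r -vy.
have /asboolP[_ [s fs]] := path_coefP f.
rewrite (path_sum fs) linear_sum.
rewrite (eq_bigr (fun p => (f p : K) *: to_quot (xs_ideal K) (path_delta K p))).
  by apply: spanned_sum => -[v w]; apply: delta_spanned.
by move=> p _; apply: linearZ.
Qed.

(** Identities in the algebra can thus be checked on coordinates, where they are
    polynomial identities over K. *)
Lemma xs_coord_inj x y : (forall i, xs_coord x i = xs_coord y i) -> x = y.
Proof.
have [u ->] := xs_elt_spans x; have [v ->] := xs_elt_spans y.
move=> uv; have {}uv i : u i = v i by rewrite -xs_coord_elt uv xs_coord_elt.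
by apply: eq_bigr => i _; rewrite uv.
Qed.

End XSCoordinates.

(** * Cocycles of the Xu-Snashall algebra *)

Section XSCocycles.
Variable K : fieldType.
Local Notation A := (xs_algebra K).

(** The terms of order t in the product of two elements when a^2 = t instead
    of a^2 = 0: a.a = t, a.ab = ab.a = t b. Products that end in c or bc are not
    deformed. *)
Definition square_a_value (u v : xs_monomial -> K) (i : xs_monomial) : K :=
  match i with
  | M1 => u Ma * v Ma
  | Mb => u Ma * v Mab + u Mab * v Ma
  | _ => 0
  end.

(** The same for b^2 = t: b.b = t, b.ab = ab.b = t a, and b.bc = t c. *)
Definition square_b_value (u v : xs_monomial -> K) (i : xs_monomial) : K :=
  match i with
  | M1 => u Mb * v Mb
  | Ma => u Mb * v Mab + u Mab * v Mb
  | Mc => u Mb * v Mbc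
  | _ => 0
  end.

Definition square_a_map (u v : A) : A :=
  xs_elt (square_a_value (xs_coord u) (xs_coord v)).
Definition square_b_map (u v : A) : A :=
  xs_elt (square_b_value (xs_coord u) (xs_coord v)).

Lemma square_a_subproof : two_cochain_fun square_a_map \in @cochain_pred K A.
Proof.
apply: two_cochain_subproof => u c x y; apply: xs_coord_inj => i;
  by rewrite xs_coordL !xs_coord_elt; case: i; rewrite /square_a_value ?xs_coordL; ring.
Qed.
Definition square_a := Cochain square_a_subproof.

Lemma square_b_subproof : two_cochain_fun square_b_map \in @cochain_pred K A.
Proof.
apply: two_cochain_subproof => u c x y; apply: xs_coord_inj => i;
  by rewrite xs_coordL !xs_coord_elt; case: i; rewrite /square_b_value ?xs_coordL; ring.
Qed.
Definition square_b := Cochain square_b_subproof.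

Lemma square_a_concentrated : concentrated 2 square_a.
Proof. by move=> [|? [|? [|? ?]]]. Qed.

Lemma square_b_concentrated : concentrated 2 square_b.
Proof. by move=> [|? [|? [|? ?]]]. Qed.

Lemma square_b_diff : hochschild_diff square_b = 0.
Proof.
apply/funext => s.
have [s3|s3] := eqVneq (size s) 3; last first.
  exact: (concentrated_diff square_b_concentrated).
case: s s3 => [|u [|v [|w [|? ?]]]] // _; rewrite [LHS]two_cochain_diff.
apply: xs_coord_inj => i; rewrite [RHS]xs_coord0 !(xs_coordD, xs_coordN) !xs_coordM.
by case: i; rewrite /xs_mul !xs_coord_elt /square_b_value ?xs_coordM /xs_mul; ring.
Qed.

(** The failure of associativity is confined to products with c on the right:
    (aa)c = tc, whereas a(ac) = 0. *)
Lemma square_a_diff s i :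
  match i with
  | Mc | Mbc => True
  | _ => xs_coord (hochschild_diff square_a s) i = 0
  end.
Proof.
have [s3|s3] := eqVneq (size s) 3; last first.
  by rewrite (concentrated_diff square_a_concentrated) //; case: i; rewrite ?xs_coord0.
case: s s3 => [|u [|v [|w [|? ?]]]] // _; rewrite [hochschild_diff _ _]two_cochain_diff.
rewrite !(xs_coordD, xs_coordN) !xs_coordM.
by case: i => //; rewrite /xs_mul !xs_coord_elt /square_a_value ?xs_coordM /xs_mul; ring.
Qed.

Definition xs_class m : cochain A := square_a ^+ m * square_b.

Lemma xs_classS m : xs_class m.+1 = square_a * xs_class m.
Proof. by rewrite /xs_class exprS mulrA. Qed.

Lemma xs_class_concentrated m : concentrated m.*2.+2 (xs_class m).
Proof.
elim: m => [|m IH]; first by rewrite /xs_class mul1r; apply: square_b_concentrated.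
by rewrite xs_classS; apply: (concentrated_cup square_a_concentrated IH).
Qed.

Lemma xs_class_step m x y s :
  xs_class m.+1 (x :: y :: s) = square_a_map x y * xs_class m s.
Proof.
rewrite xs_classS [LHS](cup_concentrated _ square_a_concentrated) // -signr_odd.
by rewrite oddM /= take0 drop0 scale1r.
Qed.

Lemma xs_class_coord2 m s : xs_coord (xs_class m s) M2 = 0.
Proof.
elim: m s => [|m IH] s.
  rewrite /xs_class mul1r.
  by case: s => [|? [|? [|? ?]]]; (rewrite [LHS]xs_coord0 || rewrite [LHS]xs_coord_elt).
case: s => [|x [|y s]]; last by rewrite xs_class_step xs_coordM /xs_mul IH mulr0.
- by rewrite xs_class_concentrated // xs_coord0.
- by rewrite xs_class_concentrated // xs_coord0.
Qed.

(** By the Leibniz rule only the coboundary of the first factor has to be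
    considered; its values lie in the span of c and bc, and these are killed by
    right factors without component at e_2. *)
Lemma xs_class_diff m : hochschild_diff (xs_class m) = 0.
Proof.
elim: m => [|m IH]; first by rewrite /xs_class mul1r square_b_diff.
rewrite xs_classS; apply/funext => s.
rewrite [LHS]hochschild_diff_cup IH /cup_fun [X in _ + X]big1 ?addr0; last first.
  by move=> k _; rewrite mulr0 scaler0.
rewrite big1 // => k _; apply: xs_coord_inj => i.
rewrite xs_coordZ xs_coord0 xs_coordM.
have := square_a_diff (take k s); have := xs_class_coord2 m (drop k s).
move: (hochschild_diff _ _) (xs_class _ _) => p q q2 p0.
have [[[[p1 pa] pb] pab] p2] := (p0 M1, p0 Ma, p0 Mb, p0 Mab, p0 M2).
by case: i; rewrite /xs_mul ?(p1, pa, pb, pab, p2, q2) ?(mul0r, mulr0, addr0).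
Qed.

End XSCocycles.

(** * Evaluation on the words in a and b *)

Section XSEvaluation.
Variable K : fieldType.
Local Notation A := (xs_algebra K).
Local Notation T := (trivial_extension A).

Definition ab_elt (x : bool) : A := xs_basis K (if x then Mb else Ma).
Definition ab_letter (x : bool) : T := (ab_elt x, 0).
Definition xs_eps (t : T) : K := xs_coord t.1 M1.

Lemma xs_epsL c x y : xs_eps (c *: x + y) = c * xs_eps x + xs_eps y.
Proof. exact: xs_coordL. Qed.

Lemma xs_epsM x y : xs_eps (x * y) = xs_eps x * xs_eps y.
Proof. exact: xs_coordM. Qed.

Lemma basis_mul0 i j :
    (forall k, xs_mul (xs_coord (xs_basis K i)) (xs_coord (xs_basis K j)) k = 0) ->
  xs_basis K i * xs_basis K j = 0.
Proof. by move=> ij; apply: xs_coord_inj => k; rewrite xs_coordM ij xs_coord0. Qed.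

Lemma xs_eval_skew :
  skew_coefs (fun z : cocycle T => shuffle_eval xs_eps ab_letter z).
Proof.
apply: shuffle_eval_skew; [exact: xs_epsL | exact: xs_epsM | exact: xs_coord1].
Qed.

Lemma xs_eval_diff (g : cochain T) n j :
  shuffle_eval xs_eps ab_letter (hochschild_diff g) n j = 0.
Proof.
apply: shuffle_eval_diff; [exact: xs_epsL | exact: xs_epsM | | |].
- by move=> x; rewrite /xs_eps xs_coord_basis; case: x.
- move=> x; rewrite mul_inl basis_mul0 // => k.
  by case: x; case: k; rewrite /xs_mul !xs_coord_basis; ring.
- rewrite !mul_inl; congr (_, _); apply: xs_coord_inj => k; rewrite !xs_coordM.
  by case: k; rewrite /xs_mul !xs_coord_basis; ring.
Qed.

(** At (a, ..., a, c), all inner terms of the differential contain aa or ac and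
    vanish, and a z(a, ..., a, c) has no component at c. *)
Lemma xs_eval_a (z : cocycle T) n : shuffle_eval xs_eps ab_letter z n.+1 0 = 0.
Proof.
have /asboolP[zL _] := cochainP z.
have z0 s t : z (s ++ 0 :: t) = 0 := multilinear0 s t zL.
rewrite /shuffle_eval shuffle_sum_n0 map_nseq.
pose a : T := ab_letter false; pose c : T := (xs_basis K Mc, 0).
have ay (y : T) : y = a \/ y = c -> a * y = 0.
  case=> ->; rewrite mul_inl basis_mul0 // => k;
  by case: k; rewrite /xs_mul !xs_coord_basis; ring.
pose s := nseq n a ++ [:: c].
have sE : a :: s = nseq n.+1 a ++ [:: c] by [].
have size_s : size (a :: s) = n.+2 by rewrite sE size_cat size_nseq addn1.
have : (-1) ^+ size (a :: s) *: (a * z s) +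
    \sum_(1 <= i < size (a :: s)) (-1) ^+ (size (a :: s) - i) *: z (contract i (a :: s)) +
    z (take (size (a :: s)).-1 (a :: s)) * last a s = 0.
  exact: (congr1 (fun f : seq T -> T => f (a :: s)) (cocycle_diff0 z)).
rewrite size_s sE take_size_cat ?size_nseq // last_cat [last _ [:: c]]/=.
rewrite big_nat big1 => [|i /andP[i_gt0 lt_i]]; last first.
  have [k ik] : exists k, n.+1 = (i.-1 + k.+1)%N.
    by exists (n - i.-1)%N; lia.
  have [y [v [kE yE]]] : exists y v, nseq k a ++ [:: c] = y :: v /\ (y = a \/ y = c).
    case: k {ik} => [|k]; first by exists c, [::]; split; [|right].
    by exists a, (nseq k a ++ [:: c]); split; [|left].
  rewrite ik nseqD -catA /= kE.
  have := contract_cat (nseq i.-1 a) v a y.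
  by rewrite size_nseq prednK // => ->; rewrite ay // z0 scaler0.
rewrite addr0 => /(congr1 (fun t : T => xs_coord t.1 Mc)).
rewrite [RHS]xs_coord0 [LHS]xs_coordD [X in X + _]xs_coordZ !xs_coordM.
rewrite /xs_mul !xs_coord_basis => <-; rewrite /xs_eps; ring.
Qed.

(** The class f_a^m f_b is nonzero on a single word, namely a^(2m) b^2, which is
    sorted and so has sign 1. *)
Lemma xs_eval_class m :
  shuffle_eval xs_eps ab_letter (cyclic_extension (xs_class K m)) m.*2.+2 2 = 1.
Proof.
transitivity (shuffle_sum m.*2.+2 2
  (fun w => xs_coord (xs_class K m (map ab_elt w)) M1)).
  apply: eq_shuffle_sum => w _; rewrite /xs_eps /= -map_comp.
  by congr (xs_coord (xs_class K m _) M1); apply: eq_map.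
elim: m => [|m IH].
  rewrite /xs_class mul1r.
  rewrite (@eq_shuffle_sum _ _ _ _ 
    (fun w => if w is [:: x; y] then (x && y)%:R else 0)).
    by rewrite /=; ring.
  case=> [|x [|y [|? ?]]] // _; rewrite [LHS]xs_coord_elt /square_b_value.
  by case: x; case: y; rewrite !xs_coord_basis /=; ring.
rewrite -[RHS]IH; set G := (X in _ = shuffle_sum _ _ X).
set F := (X in shuffle_sum _ _ X = _).
have FE x y w : F (x :: y :: w) = (~~ x && ~~ y)%:R * G w.
  rewrite -[LHS]/(xs_coord (xs_class K m.+1
    (ab_elt x :: ab_elt y :: map ab_elt w)) M1) xs_class_step xs_coordM.
  rewrite /xs_mul xs_coord_elt /square_a_value.
  by congr (_ * _); case: x; case: y; rewrite !xs_coord_basis /=; ring.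
have F0 n j x y : x || y -> shuffle_sum n j ((F \o cons x) \o cons y) = 0.
  move=> xy; rewrite -[RHS](shuffle_sum0 K n j); apply: eq_shuffle_sum => w _.
  by rewrite [LHS]FE -negb_or xy mul0r.
rewrite doubleS; clearbody F G; move: (m.*2.+2) => k.
rewrite !shuffle_sumS (F0 _ _ false true) // !(F0 _ _ true) // !(mulr0, addr0).
by apply: eq_shuffle_sum => w _; rewrite [LHS]FE mul1r.
Qed.

End XSEvaluation.

(** The evaluation of cocycles descends first to cohomology and then, because it
    kills nilpotents, to the quotient, where [skew_coefs_not_fg] applies. *)
Theorem theorem2 (K : fieldType) :
  ~ fg_algebra (quot_alg (nil_ideal (trivial_extension (xs_algebra K)))).
Proof.
set T := trivial_extension (xs_algebra K).
pose t0 (z : cocycle T) := shuffle_eval (@xs_eps K) (@ab_letter K) z.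
have s0 : skew_coefs t0 by apply: xs_eval_skew.
have [|s1 t1E] := skew_coefs_quot s0 (I := coboundaries T).
  move=> z /asboolP[g zg] n j; rewrite /t0.
  by rewrite zg xs_eval_diff.
have [|s2 t2E] := skew_coefs_quot s1 (I := nil_ideal T).
  move=> x x_nil; apply/asboolP.
  apply: (ideal_span_min (skew_kernel_ideal s1)) x_nil => y [_ [p yp]].
  by apply/asboolP => n j; apply: (skew_coefs_nilpotent s1 _ _ yp).
pose q z := to_quot (nil_ideal T) (hh_class z).
have tE z : t0 (quot_repr (quot_repr (q z))) =2 t0 z.
  by move=> n j; rewrite t2E t1E.
have qP x : exists z, x = q z.
  exists (quot_repr (quot_repr x)).
  by rewrite /q /hh_class !quot_reprK.
apply: (skew_coefs_not_fg s2) => [x|x n|N].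
- have [z ->] := qP x.
  have /asboolP[_ [N zN]] := cochainP z; exists N => n j le_n.
  rewrite tE -[RHS](shuffle_sum0 K n j); apply: eq_shuffle_sum => w wn.
  by rewrite zN ?size_map ?wn // /xs_eps xs_coord0.
- by have [z ->] := qP x; rewrite tE; apply: xs_eval_a.
- have dz : hochschild_diff (cyclic_extension (xs_class K N)) = 0.
    apply: (@cyclic_extension_cocycle _ _ _ N.*2.+2).
    + by rewrite /= odd_double.
    + exact: xs_class_concentrated.
    + exact: xs_class_diff.
  have zP : cyclic_extension (xs_class K N) \in @cocycle_pred K T by apply/asboolP.
  exists (q (Cocycle zP)), N.*2.+2; split; first by rewrite -addnn; lia.
  by rewrite tE /t0 xs_eval_class oner_neq0.
Qed.
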